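(* Let $\mathcal P$ be the set of feasible paths of the EVRPTWNL. The column generation algorithm ColumnGeneration$(\mathcal P)$ described in the context, in which the pricing problem of Step 2 is solved by the two-phase subpath-based label-setting algorithm (FindNonDominatedSubpaths followed by FindNonDominatedPaths) with the resources and domination criteria given in the context, converges in finitely many iterations to an optimal solution of the linear relaxation $\overline{\mathtt{EVRP}}(\mathcal P)$.
   Context: **Instance.** $(\mathcal V,\mathcal A)$ is a finite directed graph, $\mathcal V=\mathcal V_C\cup\mathcal V_D\cup\mathcal V_S$ a partition into customers, depots and charging stations; $T$ is the time horizon, $B$ the battery capacity, $D$ the vehicle capacity. Each arc $(i,j)$ has travel time $t_{i,j}>0$, cost $c_{i,j}>0$, battery use $b_{i,j}>0$. Each node $i$ has demand $d_i\ge 0$ and time window $[\alpha_i,\beta_i]\subseteq[0,T]$; for $i\in\mathcal V_D\cup\mathcal V_S$, $d_i=0$, $\alpha_i=0$, $\beta_i=T$. For each depot $j$, $v^{\rm start}_j$ and $v^{\rm end}_j$ are nonnegative integers. The charging function $g:\mathbb R_+\to[0,B]$ is concave, increasing, $g(0)=0$, and invertible: it is continuous, strictly increasing until it attains $B$, and $g^{-1}(b)$ is the smallest $t$ with $g(t)=b$. Set $g_T(b_1,b_2)=g^{-1}(b_2)-g^{-1}(b_1)$ and $g_C(b,t)=g(g^{-1}(b)+t)$. **Paths.** A partial path $p$ is a node sequence $(n_0,\dots,n_m)$ along arcs with $n_0\in\mathcal V_D$ and $n_1,\dots,n_{m-1}\in\mathcal V_C\cup\mathcal V_S$; it is a (complete)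 path if $m\ge1$ and $n_m\in\mathcal V_D$. It is feasible if there are charging times $\tau_k\ge0$ ($n_k\in\mathcal V_S$; put $\tau_k=0$ otherwise) such that with $t_0=0$, $b_0=B$, $t_{k+1}=\max\{t_k+\tau_k+t_{n_k,n_{k+1}},\alpha_{n_{k+1}}\}$, and $b_{k+1}=g_C(b_k,\tau_k)-b_{n_k,n_{k+1}}$ if $n_k\in\mathcal V_S$, $b_{k+1}=b_k-b_{n_k,n_{k+1}}$ otherwise, one has $\sum_k d_{n_k}\le D$, $b_k\in[0,B]$, $t_k\in[\alpha_{n_k},\beta_{n_k}]$ for all $k$. For a path $p$: $c^p$ is the sum of its arc costs; $\gamma_i^p$ is the number of visits to $i\in\mathcal V_C$; $\sigma^p_{j,\rm start},\sigma^p_{j,\rm end}\in\{0,1\}$ indicate whether $p$ starts, ends at depot $j$. **Master problem.** For a set of feasible paths $\mathcal P'$, $\overline{\mathtt{EVRP}}(\mathcal P')$ is the linear program: minimize $\sum_{p\in\mathcal P'}c^pz^p$ subject to $\sum_p\sigma^p_{j,\rm start}z^p=v_j^{\rm start}$ and $\sum_p\sigma^p_{j,\rm end}z^p\ge v_j^{\rm end}$ for all $j\in\mathcal V_D$, $\sum_p\gamma_i^pz^p=1$ for all $i\in\mathcal V_C$, $z\ge0$. Dual variables of the three constraint families are $\kappa,\mu,\nu$. The reduced cost of $p$ is $\overline c(p)=c^p-\kappa_{\rm start(p)}-\mu_{\rm end(p)}-\sum_i\gamma_i^p\nu_i$, which is the sum over the arcs of $p$ of $\overline c_{i,j}=c_{i,j}-\mathbb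 1(i\in\mathcal V_D)\kappa_i-\mathbb 1(j\in\mathcal V_D)\mu_j-\mathbb 1(j\in\mathcal V_C)\nu_j$. **ColumnGeneration$(\mathcal P)$.** Start with $\mathcal P_0\subset\mathcal P$ such that $\overline{\mathtt{EVRP}}(\mathcal P_0)$ is feasible. At each iteration $\ell$: (Step 1) solve $\overline{\mathtt{EVRP}}(\mathcal P_\ell)$, obtaining an optimal primal solution $z_\ell$ and dual solution $\kappa,\mu,\nu$; (Step 2) solve the pricing problem to generate a set $\mathcal P_{\rm new}$ of paths of negative reduced cost (here: the paths of negative reduced cost returned by the two-phase algorithm below); (Step 3) if $\mathcal P_{\rm new}=\emptyset$, stop and return $z_\ell$; otherwise set $\mathcal P_{\ell+1}=\mathcal P_\ell\cup\mathcal P_{\rm new}$ and continue. **Subpaths.** A partial subpath $s$ is a node sequence $(n_0,\dots,n_m)$ along arcs with $n_0\in\mathcal V_D\cup\mathcal V_S$, $n_1,\dots,n_{m-1}\in\mathcal V_C$; it is a (complete) subpath if $m\ge1$ and $n_m\in\mathcal V_D\cup\mathcal V_S$. It is feasible if there is $(t_0,b_0)$ such that, with $t_{k+1}=\max\{t_k+t_{n_k,n_{k+1}},\alpha_{n_{k+1}}\}$ and $b_{k+1}=b_k-b_{n_k,n_{k+1}}$, one has $\sum_k d_{n_k}\le D$, $b_k\in[0,B]$, $t_k\in[\alpha_{n_k},\beta_{n_k}]$ for all $k$. An arc $a=(n_m,n')$ extends $s$ to $s\oplus a$. Resources: $\overline c(s)=\sum_\ell\overline c_{n_\ell,n_{\ell+1}}$;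 $B(s)=\sum_\ell b_{n_\ell,n_{\ell+1}}$; $D(s)=\sum_{\ell=0}^m d_{n_\ell}$; $T^{\rm travel}(s)=\sum_\ell t_{n_\ell,n_{\ell+1}}$; $T^{\rm end}_{\min}(s)=T^E_m$ with $T^E_0=\alpha_{n_0}$, $T^E_{\ell+1}=\max\{T^E_\ell+t_{n_\ell,n_{\ell+1}},\alpha_{n_{\ell+1}}\}$; $T^{\rm start}_{\max}(s)=T^L_0$ with $T^L_m=\beta_{n_m}$, $T^L_\ell=\min\{T^L_{\ell+1}-t_{n_\ell,n_{\ell+1}},\beta_{n_\ell}\}$; $Q(s)=\max\{T^{\rm travel}(s),T^{\rm end}_{\min}(s)-T^{\rm start}_{\max}(s)\}$. For feasible partial subpaths with same start and end nodes, $s_1\succeq s_2$ iff $\overline c(s_1)\le\overline c(s_2)$, $D(s_1)\le D(s_2)$, $B(s_1)\le B(s_2)$, $T^{\rm end}_{\min}(s_1)\le T^{\rm end}_{\min}(s_2)$, $T^{\rm start}_{\max}(s_1)\ge T^{\rm start}_{\max}(s_2)$, $Q(s_1)\le Q(s_2)$. **Path labels.** Partial paths in the second phase end at non-customer nodes and are concatenations $p=(s_1,\dots,s_m)$ of subpaths (or a single depot node). A subpath $s$ extends $p$ if the end node of $p$ equals the start node of $s$ and is in $\mathcal V_S$ (or $p$ is the single depot node at which $s$ starts); concatenation is $p\oplus s$. Resources: $\overline c(p)$ (sum of $\overline c_{i,j}$ over arcs); $D(p)$ (total load); $T^{\rm end}_{\min}(p)$, the minimum of $T^{\rm end}_m$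 subject to $T^{\rm start}_1=0$; $T^{\rm start}_k\le T^{\rm start}_{\max}(s_k)$; $T^{\rm end}_m\le T$; $T^{\rm start}_{k+1}=T^{\rm end}_k+\tau_k$; $T^{\rm end}_k=\max\{T^{\rm start}_k+T^{\rm travel}(s_k),T^{\rm end}_{\min}(s_k)\}$; $B^{\rm start}_1=B$; $B^{\rm end}_k=B^{\rm start}_k-B(s_k)$; $B^{\rm start}_{k+1}=g_C(B^{\rm end}_k,\tau_k)$; all variables nonnegative; and $B^{\rm end}_{\max}(p)$, the maximum of $B^{\rm end}_m$ under the same constraints plus $T^{\rm end}_m=T^{\rm end}_{\min}(p)$. (Single depot node: $0,0,0,B$.) For feasible partial paths with same start and end nodes, $p_1\succeq p_2$ iff $\overline c(p_1)\le\overline c(p_2)$, $D(p_1)\le D(p_2)$, and $T^{\rm end}_{\min}(p_1)+g_T(B^{\rm end}_{\max}(p_1),\max\{B^{\rm end}_{\max}(p_1),B^{\rm end}_{\max}(p_2)\})\le T^{\rm end}_{\min}(p_2)$. **FindNonDominatedSubpaths.** Start with $\mathcal S_{\rm gen}=\emptyset$ and $\mathcal S_{\rm queue}$ = all single-node partial subpaths at nodes of $\mathcal V_D\cup\mathcal V_S$. While $\mathcal S_{\rm queue}\ne\emptyset$: select $s\in\mathcal S_{\rm queue}$ with smallest $T^{\rm travel}(s)$, move it to $\mathcal S_{\rm gen}$; if $s$ is not complete, then for each arc $a$ extending $s$: if $s\oplus a$ is infeasible or dominated by an element of $\mathcal S_{\rm queue}\cup\mathcal S_{\rm gen}$, discard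 it; otherwise remove from $\mathcal S_{\rm queue}$ every $s'$ with $s\oplus a\succeq s'$ and add $s\oplus a$. Return the set $\mathcal S^*$ of complete subpaths in $\mathcal S_{\rm gen}$. **FindNonDominatedPaths**$(\mathcal S^* )$. Same procedure with $\mathcal P_{\rm gen}=\emptyset$, $\mathcal P_{\rm queue}$ = single-node partial paths at depots, selection by smallest $T^{\rm end}_{\min}(p)$, extensions of incomplete $p$ by all $s\in\mathcal S^*$ extending $p$, and the path domination relation. Return the complete paths in $\mathcal P_{\rm gen}$. *)

(* Defs.v *)
From Stdlib Require Export Relation_Operators.
From mathcomp Require Export all_boot all_order all_algebra.
From mathcomp Require Export all_classical all_reals all_analysis.
Set Implicit Arguments.
Unset Strict Implicit.
Unset Printing Implicit Defensive.
Import Order.TTheory GRing.Theory Num.Theory.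
Import numFieldNormedType.Exports.
Local Open Scope classical_set_scope.
Local Open Scope ring_scope.

(** * Nondeterministic programs *)

(* Total correctness of a nondeterministic program from state [s0]: no run is
   infinite, and a run that cannot be continued (in particular, one that is
   stuck) has reached a state satisfying [post]. *)
Definition always_ends_in (S : Type) (step : S -> S -> Prop) (s0 : S)
    (post : S -> Prop) : Prop :=
  ~ (exists u : nat -> S, u 0%N = s0 /\ forall n, step (u n) (u n.+1)) /\
  (forall s, clos_refl_trans S step s0 s -> (forall s', ~ step s s') -> post s).

(** * Generic label-setting loop *)

(* [ls_todo] holds the extensions of the last selected label that the inner
   "for each" loop has not treated yet; they are treated in an arbitrary
   order.  Ties in the selection rule are broken arbitrarily. *)
Record ls_state (L : Type) :=
  LS { ls_gen : set L; ls_queue : set L; ls_todo : set L }.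

Section LabelSetting.
Variables (R : realType) (L : Type).
Variables (key : L -> R) (complete : L -> bool) (ext : L -> set L).
Variables (feasible : L -> Prop) (dominates : L -> L -> Prop).

Definition ls_init (roots : set L) : ls_state L := LS set0 roots set0.

Definition ls_dominated (gen queue : set L) (e : L) : Prop :=
  exists2 l, (queue `|` gen) l & dominates l e.

Variant ls_step : ls_state L -> ls_state L -> Prop :=
| LSSelect (gen queue : set L) s of
    queue s & (forall s', queue s' -> key s <= key s') :
    ls_step (LS gen queue set0)
            (LS (s |` gen) (queue `\ s) (if complete s then set0 else ext s))
| LSDiscard (gen queue todo : set L) e of
    todo e & ~ feasible e \/ ls_dominated gen queue e :
    ls_step (LS gen queue todo) (LS gen queue (todo `\ e))
| LSInsert (gen queue todo : set L) e of
    todo e & feasible e & ~ ls_dominated gen queue e :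
    ls_step (LS gen queue todo)
            (LS gen (e |` (queue `\` [set l | dominates e l])) (todo `\ e)).

Definition ls_done (st : ls_state L) : Prop :=
  ls_queue st = set0 /\ ls_todo st = set0.

Definition ls_result (st : ls_state L) : set L :=
  [set l | ls_gen st l /\ complete l].

End LabelSetting.

(** * Instances *)

Variant node_kind := Customer | Depot | Station.

Record instance (R : realType) := Instance {
  node :> finType;
  kind : node -> node_kind;
  is_arc : rel node;
  horizon : R;
  battery : R;
  capacity : R;
  time : node -> node -> R;
  cost : node -> node -> R;
  energy : node -> node -> R;
  demand : node -> R;
  tw_open : node -> R;
  tw_close : node -> R;
  vstart : node -> nat;
  vend : node -> nat;
  (* [recharge] is only meaningful on the nonnegative half-line. *)
  recharge : R -> R;
  time_gt0 : forall i j, is_arc i j -> 0 < time i j;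
  cost_gt0 : forall i j, is_arc i j -> 0 < cost i j;
  energy_gt0 : forall i j, is_arc i j -> 0 < energy i j;
  demand_ge0 : forall i, 0 <= demand i;
  tw_sub : forall i, 0 <= tw_open i /\ tw_open i <= tw_close i
                     /\ tw_close i <= horizon;
  facility_trivial : forall i, kind i <> Customer ->
    [/\ demand i = 0, tw_open i = 0 & tw_close i = horizon];
  recharge_range : forall t : R, 0 <= t -> 0 <= recharge t <= battery;
  recharge0 : recharge 0 = 0;
  recharge_concave : forall x y a : R, 0 <= x -> 0 <= y -> 0 <= a <= 1 ->
    a * recharge x + (1 - a) * recharge y <= recharge (a * x + (1 - a) * y);
  recharge_nondecreasing : forall x y : R, 0 <= x -> x <= y ->
    recharge x <= recharge y;
  recharge_increasing : forall x y : R, 0 <= x -> x < y -> recharge x < battery ->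
    recharge x < recharge y;
  recharge_continuous : {within [set t : R | 0 <= t], continuous recharge};
  recharge_full : exists2 t : R, 0 <= t & recharge t = battery
}.

Section EVRP.
Variables (R : realType) (I : instance R).
Implicit Types (i j : I).

Definition is_customer i := if kind i is Customer then true else false.
Definition is_depot i := if kind i is Depot then true else false.
Definition is_station i := if kind i is Station then true else false.

Definition recharge_inv (b : R) : R :=
  inf [set t : R | 0 <= t /\ recharge I t = b].
Definition g_T (b1 b2 : R) : R := recharge_inv b2 - recharge_inv b1.
Definition g_C (b t : R) : R := recharge I (recharge_inv b + t).

(* The nonempty sequence (n_0, ..., n_m) is the pair of n_0 and
   [:: n_1; ...; n_m]; thus m is [size s.2]. *)
Definition nodeseq : Type := (node I * seq (node I))%type.
Implicit Types (s p : nodeseq).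

Definition nodes s : seq I := s.1 :: s.2.
Definition node_at s k : I := nth s.1 (nodes s) k.
Definition end_node s : I := last s.1 s.2.
Definition arcs s : seq (I * I) := zip (nodes s) s.2.

Definition along_arcs s : bool := path (@is_arc R I) s.1 s.2.

Definition arc_sum (f : I -> I -> R) s : R := \sum_(a <- arcs s) f a.1 a.2.
Definition load s : R := \sum_(i <- nodes s) demand i.

(** * Paths and the master problem *)

Definition partial_path p : Prop :=
  [/\ along_arcs p, is_depot p.1 &
      forall k, (0 < k < size p.2)%N ->
        is_customer (node_at p k) || is_station (node_at p k)].

Definition complete_path p : bool := (0 < size p.2)%N && is_depot (end_node p).

Definition feasible_partial_path p : Prop :=
  partial_path p /\
  exists tau t b : nat -> R,
    [/\ (forall k, 0 <= tau k) /\
        (forall k, (k <= size p.2)%N -> ~~ is_station (node_at p k) ->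
          tau k = 0),
        t 0%N = 0 /\ b 0%N = battery I,
        (forall k, (k < size p.2)%N ->
          t k.+1 = Num.max (t k + tau k + time (node_at p k) (node_at p k.+1))
                           (tw_open (node_at p k.+1)) /\
          b k.+1 = (if is_station (node_at p k) then g_C (b k) (tau k) else b k)
                   - energy (node_at p k) (node_at p k.+1)),
        load p <= capacity I &
        forall k, (k <= size p.2)%N ->
          0 <= b k <= battery I /\
          tw_open (node_at p k) <= t k <= tw_close (node_at p k)].

(* This set is finite: travel times are positive and bounded below on the
   finitely many arcs, and arrival times are at most [horizon].  Hence the
   finitely supported sums over sets of paths below are ordinary sums. *)
Definition feasible_paths : set nodeseq :=
  [set p | feasible_partial_path p /\ complete_path p].

Definition path_cost p : R := arc_sum (@cost R I) p.
Definition visits i p : nat := count_mem i (nodes p).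
Definition starts_at j p : R := (p.1 == j)%:R.
Definition ends_at j p : R := (end_node p == j)%:R.

(* A vector indexed by P is a function on node sequences that vanishes
   outside P. *)
Definition master_feasible (P : set nodeseq) (z : nodeseq -> R) : Prop :=
  [/\ (forall p, ~ P p -> z p = 0) /\ (forall p, 0 <= z p),
      forall j, is_depot j -> \sum_(p \in P) starts_at j p * z p = (vstart j)%:R,
      forall j, is_depot j -> (vend j)%:R <= \sum_(p \in P) ends_at j p * z p &
      forall i, is_customer i -> \sum_(p \in P) (visits i p)%:R * z p = 1].

Definition master_value (P : set nodeseq) (z : nodeseq -> R) : R :=
  \sum_(p \in P) path_cost p * z p.

Definition master_optimal (P : set nodeseq) (z : nodeseq -> R) : Prop :=
  master_feasible P z /\
  forall z', master_feasible P z' -> master_value P z <= master_value P z'.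

(* Only the values of [kappa] and [mu] at depots and of [nu] at customers are
   used. *)
Record duals := Duals { kappa : I -> R; mu : I -> R; nu : I -> R }.
Implicit Types (y : duals).

Definition reduced_cost y p : R :=
  path_cost p - kappa y p.1 - mu y (end_node p)
  - \sum_(i | is_customer i) (visits i p)%:R * nu y i.

Definition dual_feasible (P : set nodeseq) y : Prop :=
  (forall j, is_depot j -> 0 <= mu y j) /\
  (forall p, P p -> 0 <= reduced_cost y p).

Definition dual_value y : R :=
  \sum_(j | is_depot j) (vstart j)%:R * kappa y j
  + \sum_(j | is_depot j) (vend j)%:R * mu y j
  + \sum_(i | is_customer i) nu y i.

Definition dual_optimal (P : set nodeseq) y : Prop :=
  dual_feasible P y /\
  forall y', dual_feasible P y' -> dual_value y' <= dual_value y.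

Definition reduced_arc_cost y i j : R :=
  cost i j - (if is_depot i then kappa y i else 0)
  - (if is_depot j then mu y j else 0)
  - (if is_customer j then nu y j else 0).

(** * Subpaths *)

Definition partial_subpath s : Prop :=
  [/\ along_arcs s, is_depot s.1 || is_station s.1 &
      forall k, (0 < k < size s.2)%N -> is_customer (node_at s k)].

Definition complete_subpath s : bool :=
  (0 < size s.2)%N && (is_depot (end_node s) || is_station (end_node s)).

Definition feasible_subpath s : Prop :=
  partial_subpath s /\
  exists t b : nat -> R,
    [/\ (forall k, (k < size s.2)%N ->
          t k.+1 = Num.max (t k + time (node_at s k) (node_at s k.+1))
                           (tw_open (node_at s k.+1)) /\
          b k.+1 = b k - energy (node_at s k) (node_at s k.+1)),
        load s <= capacity I &
        forall k, (k <= size s.2)%N ->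
          0 <= b k <= battery I /\
          tw_open (node_at s k) <= t k <= tw_close (node_at s k)].

Definition travel_time s : R := arc_sum (@time R I) s.
Definition battery_use s : R := arc_sum (@energy R I) s.

Fixpoint end_time_from (t : R) i (q : seq I) : R :=
  if q is j :: q' then
    end_time_from (Num.max (t + time i j) (tw_open j)) j q'
  else t.
Definition sub_end_min s : R := end_time_from (tw_open s.1) s.1 s.2.

Fixpoint latest_start i (q : seq I) : R :=
  if q is j :: q' then Num.min (latest_start j q' - time i j) (tw_close i)
  else tw_close i.
Definition sub_start_max s : R := latest_start s.1 s.2.

Definition sub_duration s : R :=
  Num.max (travel_time s) (sub_end_min s - sub_start_max s).

Definition subpath_dominates y s1 s2 : Prop :=
  [/\ feasible_subpath s1 /\ feasible_subpath s2,
      s1.1 = s2.1 /\ end_node s1 = end_node s2,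
      arc_sum (reduced_arc_cost y) s1 <= arc_sum (reduced_arc_cost y) s2,
      load s1 <= load s2 /\ battery_use s1 <= battery_use s2 &
      [/\ sub_end_min s1 <= sub_end_min s2,
          sub_start_max s2 <= sub_start_max s1 &
          sub_duration s1 <= sub_duration s2]].

Definition subpath_roots : set nodeseq :=
  [set s | s.2 = [::] /\ (is_depot s.1 || is_station s.1)].

Definition subpath_ext s : set nodeseq :=
  [set (s.1, rcons s.2 j) | j in [set j | is_arc (end_node s) j]].

Definition subpath_step y : ls_state nodeseq -> ls_state nodeseq -> Prop :=
  ls_step travel_time complete_subpath subpath_ext feasible_subpath
    (subpath_dominates y).

(** * Path labels *)

(* The label (n_0, [:: s_1; ...; s_m]) is the concatenation of s_1, ..., s_m,
   where s_1 starts at the depot n_0; for m = 0 it is the single node n_0. *)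
Definition plabel : Type := (node I * seq nodeseq)%type.
Implicit Types (l : plabel).

Definition concat l : nodeseq := (l.1, flatten [seq s.2 | s <- l.2]).
Definition subpath_at l k : nodeseq := nth (l.1, [::]) l.2 k.

(* [Ts], [Te], [Bs], [Be], [tau] are the start and end times, the start and
   end battery levels and the charging times; index k stands for the subpath
   s_(k+1), and [tau k] is spent between s_(k+1) and s_(k+2). *)
Definition schedule l (Ts Te Bs Be tau : nat -> R) : Prop :=
  [/\ Ts 0%N = 0 /\ Bs 0%N = battery I,
      Te (size l.2).-1 <= horizon I,
      forall k, (k < size l.2)%N ->
        [/\ Ts k <= sub_start_max (subpath_at l k),
            Te k = Num.max (Ts k + travel_time (subpath_at l k))
                           (sub_end_min (subpath_at l k)) &
            Be k = Bs k - battery_use (subpath_at l k)],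
      forall k, (k.+1 < size l.2)%N ->
        Ts k.+1 = Te k + tau k /\ Bs k.+1 = g_C (Be k) (tau k) &
      (forall k, (k < size l.2)%N ->
        [/\ 0 <= Ts k, 0 <= Te k, 0 <= Bs k & 0 <= Be k]) /\
      (forall k, (k.+1 < size l.2)%N -> 0 <= tau k)].

(* The infimum and the supremum are attained when the label is feasible. *)
Definition path_end_min l : R :=
  if l.2 is [::] then 0 else
  inf [set t | exists Ts Te Bs Be tau,
         schedule l Ts Te Bs Be tau /\ t = Te (size l.2).-1].

Definition path_battery_max l : R :=
  if l.2 is [::] then battery I else
  sup [set b | exists Ts Te Bs Be tau,
         [/\ schedule l Ts Te Bs Be tau, Te (size l.2).-1 = path_end_min l &
             b = Be (size l.2).-1]].

Definition feasible_plabel l : Prop := feasible_partial_path (concat l).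
Definition complete_plabel l : bool := complete_path (concat l).

Definition plabel_dominates y l1 l2 : Prop :=
  [/\ feasible_plabel l1 /\ feasible_plabel l2,
      l1.1 = l2.1 /\ end_node (concat l1) = end_node (concat l2),
      arc_sum (reduced_arc_cost y) (concat l1)
        <= arc_sum (reduced_arc_cost y) (concat l2),
      load (concat l1) <= load (concat l2) &
      path_end_min l1
        + g_T (path_battery_max l1)
              (Num.max (path_battery_max l1) (path_battery_max l2))
      <= path_end_min l2].

Definition plabel_roots : set plabel := [set l | l.2 = [::] /\ is_depot l.1].

Definition extends l s : Prop :=
  end_node (concat l) = s.1 /\ (is_station s.1 \/ l.2 = [::]).

Definition plabel_ext (Sstar : set nodeseq) l : set plabel :=
  [set (l.1, rcons l.2 s) | s in [set s | Sstar s /\ extends l s]].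

Definition plabel_step (Sstar : set nodeseq) y :
    ls_state plabel -> ls_state plabel -> Prop :=
  ls_step path_end_min complete_plabel (plabel_ext Sstar) feasible_plabel
    (plabel_dominates y).

(** * Column generation *)

(* [Subpaths] and [Paths] are the states inside the first and second phase of
   the pricing problem; they remember the current set of paths and the master
   solutions. *)
Variant cg_state :=
| Master of set nodeseq
| Subpaths of set nodeseq & (nodeseq -> R) & duals & ls_state nodeseq
| Paths of set nodeseq & (nodeseq -> R) & duals & set nodeseq & ls_state plabel
| Returned of nodeseq -> R.

Definition new_paths y (st : ls_state plabel) : set nodeseq :=
  [set p | (concat @` ls_result complete_plabel st) p /\ reduced_cost y p < 0].

Variant cg_step : cg_state -> cg_state -> Prop :=
| CGSolve P z y of master_optimal P z & dual_optimal P y :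
    cg_step (Master P) (Subpaths P z y (ls_init subpath_roots))
| CGSubpath P z y st st' of subpath_step y st st' :
    cg_step (Subpaths P z y st) (Subpaths P z y st')
| CGSubpathsDone P z y st of ls_done st :
    cg_step (Subpaths P z y st)
      (Paths P z y (ls_result complete_subpath st) (ls_init plabel_roots))
| CGPath P z y Sstar st st' of plabel_step Sstar y st st' :
    cg_step (Paths P z y Sstar st) (Paths P z y Sstar st')
| CGStop P z y Sstar st of ls_done st & new_paths y st = set0 :
    cg_step (Paths P z y Sstar st) (Returned z)
| CGContinue P z y Sstar st of ls_done st & new_paths y st <> set0 :
    cg_step (Paths P z y Sstar st) (Master (P `|` new_paths y st)).

End EVRP.

(* Main.v *)
Require Import Defs.
From Stdlib Require Wf_nat Lexicographic_Product.
From mathcomp Require Import finmap.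
From mathcomp Require Import lra zify ring.
Set Implicit Arguments.
Unset Strict Implicit.
Unset Printing Implicit Defensive.
Import Order.TTheory GRing.Theory Num.Theory.
Import numFieldNormedType.Exports.
Local Open Scope classical_set_scope.
Local Open Scope ring_scope.

(** Column generation only adds paths of negative reduced cost, and the paths
    that it already has have nonnegative reduced cost, so every iteration that
    does not stop enlarges a subset of the finite set of feasible paths.  When it
    stops with an optimal primal solution [z] and an optimal dual solution [y] of
    the restricted problem, exactness of the pricing step makes [y] dual feasible
    for all feasible paths, and strong duality for the restricted problem with
    weak duality for the full one makes [z] optimal ([master_optimal_extend]).
    Strong duality, and the existence of [z] and [y], come from the lemma of
    Farkas ([farkas], [lp_strong_duality]).

    Each label-setting loop ends because a label is selected at most once among
    finitely many.  At the end every feasible label is dominated by a generated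
    one ([subpath_cover], [plabel_cover]), by induction on the number of
    extensions that form it, as soon as domination is reflexive, transitive and
    preserved by extensions.  For subpaths the last property is
    [subpath_dominates_rcons].  The first phase may lose a cycle of nonnegative
    reduced cost, dominated by its initial node; such a cycle can be dropped from
    a path ([plabel_dominates_cycle]).

    For paths, the point is that two numbers describe everything a label can
    still do: its earliest end time and the largest energy level at that time
    ([frontier]).  Any run that ends later has at most the energy obtained by
    charging during the difference.  This is where concavity matters: charging at
    a station on the way instead of at the end happens at a higher energy level,
    hence is not faster ([frontier_step]).  Domination then compares the two
    charging curves that start at these points, and replacing a label and the
    subpath that extends it by dominating ones, with the same departure time,
    loses neither time nor energy ([plabel_dominates_rcons]).  A path is split at
    its stations into the subpaths of a label ([decompose_path]). *)

(** * Finiteness and termination *)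

Lemma finite_bounded_seqs (T : choiceType) (A : set T) (n : nat) :
  finite_set A ->
  finite_set [set q : seq T | (size q <= n)%N /\ forall x, x \in q -> A x].
Proof.
move=> fA; elim: n => [|n IHn].
  by apply: sub_finite_set (finite_set1 [::]) => -[|x q] [].
apply: sub_finite_set (_ : finite_set ([::] |` (image2 A _ cons))); last first.
  by rewrite finite_setU; split; [exact: finite_set1|exact: finite_image2 IHn].
move=> [|x q] [/= szq Aq]; [by left|right; exists x; first exact/Aq/mem_head].
by exists q => //; split=> // y yq; apply: Aq; rewrite inE yq orbT.
Qed.

Lemma argmin_finite (R : realType) (T : choiceType) (A : set T) (f : T -> R) :
  finite_set A -> A !=set0 -> exists2 x, A x & forall y, A y -> f x <= f y.
Proof.
move=> /finite_seqP[s ->] [x0 /= x0s].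
have: exists2 x, x \in s & forall y, y \in s -> f x <= f y; last first.
  by move=> [x]; exists x.
elim: s x0 x0s => // a [|b s] IHs _ _.
  by exists a; rewrite ?mem_head// => y; rewrite inE => /eqP ->.
have [x xs minx] := IHs b (mem_head _ _).
have [fax|fxa] := leP (f a) (f x).
  exists a; rewrite ?mem_head// => y; rewrite inE => /orP[/eqP->//|/minx].
  exact: le_trans.
exists x; first by rewrite inE xs orbT.
by move=> y; rewrite inE => /orP[/eqP->|/minx//]; exact: ltW.
Qed.

Lemma card_setD_proper (T : choiceType) (U A B : set T) x :
  finite_set U -> A `<=` B -> U x -> ~ A x -> B x ->
  (#|` fset_set (U `\` B)| < #|` fset_set (U `\` A)|)%N.
Proof.
move=> fU AB Ux Ax Bx.
have fUD C : finite_set (U `\` C) by exact: finite_setD.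
apply: fproper_ltn_card; rewrite fproperEneq; apply/andP; split; last first.
  by rewrite -fset_set_sub// => y [Uy nBy]; split=> // /AB.
apply/eqP => /fset_set_inj; move=> /(_ (fUD _) (fUD _)) E.
have : (U `\` B) x by rewrite E.
by case.
Qed.

Lemma card_setD1 (T : choiceType) (A : set T) x : finite_set A -> A x ->
  (#|` fset_set (A `\ x)| < #|` fset_set A|)%N.
Proof.
move=> fA Ax.
have := @card_setD_proper T A set0 [set x] x fA; rewrite setD0; apply => //.
Qed.

(** The lexicographic order on quadruples of natural numbers. *)
Definition lex4 : (nat * nat) * (nat * nat) -> (nat * nat) * (nat * nat) -> Prop :=
  slexprod _ _ (slexprod _ _ lt lt) (slexprod _ _ lt lt).

Lemma no_infinite_descent (S T : Type) (lt_T : T -> T -> Prop) (step : S -> S -> Prop)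
    (inv : S -> Prop) (m : S -> T) (s0 : S) :
  well_founded lt_T -> inv s0 ->
  (forall s s', inv s -> step s s' -> inv s' /\ lt_T (m s') (m s)) ->
  ~ exists u : nat -> S, u 0%N = s0 /\ forall n, step (u n) (u n.+1).
Proof.
move=> wf_lt inv0 dec [u [u0 su]].
have invu n : inv (u n).
  by elim: n => [|n IHn]; [rewrite u0|case: (dec _ _ IHn (su n))].
suff no x : forall n, m (u n) = x -> False by exact: (no (m (u 0%N)) 0%N).
elim/(well_founded_ind wf_lt): x => x IHx n mun.
apply: (IHx (m (u n.+1)) _ n.+1) => //.
by rewrite -mun; case: (dec _ _ (invu n) (su n)).
Qed.

Lemma wf_lex4 : well_founded lex4.
Proof. by do !apply: Lexicographic_Product.wf_slexprod; exact: Wf_nat.lt_wf. Qed.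

(** * The label-setting loop *)

Section LabelSettingTheory.
Variables (R : realType) (L : choiceType).
Variables (key : L -> R) (complete : L -> bool) (ext : L -> set L).
Variables (feasible : L -> Prop) (dominates : L -> L -> Prop).
Variables (roots U : set L).
Hypothesis finU : finite_set U.
Hypothesis rootsU : roots `<=` U.
Hypothesis extU : forall l e, U l -> ~~ complete l -> ext l e -> feasible e -> U e.
Hypothesis fin_ext : forall l, U l -> finite_set (ext l).
Hypothesis dom_refl : forall l, U l -> feasible l -> dominates l l.
Hypothesis dom_trans : forall l1 l2 l3, U l1 -> U l2 -> U l3 ->
  dominates l1 l2 -> dominates l2 l3 -> dominates l1 l3.

Let step := ls_step key complete ext feasible dominates.

(** The invariant of the loop: every feasible root and every feasible
    extension already treated is dominated by a label that is queued or generated. *)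
Record ls_inv (st : ls_state L) : Prop := LSInv {
  ls_genU : ls_gen st `<=` U;
  ls_queueU : ls_queue st `<=` U;
  ls_disj : forall l, ls_gen st l -> ~ ls_queue st l;
  ls_todo_fin : finite_set (ls_todo st);
  ls_todoU : forall e, ls_todo st e -> feasible e -> U e;
  ls_cov_root : forall r, roots r -> feasible r ->
    ls_dominated dominates (ls_gen st) (ls_queue st) r;
  ls_cov_ext : forall l e, ls_gen st l -> ~~ complete l -> ext l e -> feasible e ->
    ls_todo st e \/ ls_dominated dominates (ls_gen st) (ls_queue st) e }.

Lemma ls_inv_init : ls_inv (ls_init roots).
Proof.
split=> //=.
move=> r rr fr; exists r; first by left.
exact: (dom_refl (rootsU rr) fr).
Qed.

Lemma ls_inv_step st st' : ls_inv st -> step st st' -> ls_inv st'.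
Proof.
move=> + stst'; case: stst' => {st st'}.
- move=> gen queue s qs _ [/= gU qU dj _ _ cr ce].
  have Us : U s := qU _ qs.
  have dom e : ls_dominated dominates gen queue e ->
      ls_dominated dominates (s |` gen) (queue `\ s) e.
    move=> [l [ql|gl] dle]; last by exists l => //; right; right.
    have [ls|ls] := eqVneq l s; first by exists l => //; right; left.
    by exists l => //; left; split=> //; apply/eqP.
  split=> /=.
  + by move=> l [->|/gU].
  + by move=> l [/qU].
  + by move=> l [->|gl] [ql lns]; [exact: lns|exact: (dj l)].
  + by case: ifP => _; [exact: finite_set0|exact: fin_ext].
  + by case: ifPn => // ns e es; exact: extU es.
  + by move=> r rr fr; apply/dom/cr.
  + move=> l e [->|gl] nl el fe; first by rewrite (negbTE nl); left.
    by right; apply: dom; case: (ce l e gl nl el fe).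
- move=> gen queue todo e te bad [/= gU qU dj tf tU cr ce]; split=> //=.
  + exact: finite_setD.
  + by move=> x [/tU].
  + move=> l x gl nl lx fx; have [xe|/eqP xe] := eqVneq x e.
      by right; case: bad; rewrite -xe.
    by case: (ce l x gl nl lx fx) => [tx|]; [left|right].
- move=> gen queue todo e te fe nd [/= gU qU dj tf tU cr ce].
  have Ue : U e := tU _ te fe.
  have Uall x : (gen `|` queue) x -> U x by case=> [/gU|/qU].
  have dom x : U x -> ls_dominated dominates gen queue x ->
      ls_dominated dominates gen (e |` (queue `\` [set l | dominates e l])) x.
    move=> Ux [l [ql|gl] dlx]; last by exists l => //; right.
    have [del|ndel] := pselect (dominates e l); last first.
      by exists l => //; left; right.
    by exists e; [left; left|apply: dom_trans dlx => //; exact: qU].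
  split=> //=.
  + by move=> l [->//|[/qU]].
  + move=> l gl [le|[ql _]]; last exact: (dj l).
    by apply: nd; exists e; [right; rewrite -le|exact: dom_refl].
  + exact: finite_setD.
  + by move=> x [/tU].
  + by move=> r rr fr; apply: dom; [exact: rootsU|exact: cr].
  + move=> l x gl nl lx fx; have Ux : U x by exact: (extU (gU _ gl) nl lx fx).
    have [xe|/eqP xe] := eqVneq x e.
      right; exists e; first by left; left.
      by rewrite xe; exact: dom_refl.
    by case: (ce l x gl nl lx fx) => [tx|/dom]; [left|right; auto].
Qed.

(** Selections add a label to the generated ones; the other steps remove an
    extension from those still to be treated. *)
Definition ls_measure (st : ls_state L) : nat * nat :=
  (#|` fset_set (U `\` ls_gen st)|, #|` fset_set (ls_todo st)|)%N.

Lemma ls_measure_step st st' : ls_inv st -> step st st' ->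
  slexprod _ _ lt lt (ls_measure st') (ls_measure st).
Proof.
move=> + stst'; case: stst' => {st st'}.
- move=> gen queue s qs _ [/= gU qU dj _ _ _ _]; apply: left_slex; apply/ssrnat.ltP.
  apply: (@card_setD_proper _ _ _ _ s) => //=; [exact: qU| |by left].
  by move=> /dj.
- move=> gen queue todo e te _ [/= _ _ _ tf _ _ _]; apply: right_slex.
  exact/ssrnat.ltP/card_setD1.
- move=> gen queue todo e te _ _ [/= _ _ _ tf _ _ _]; apply: right_slex.
  exact/ssrnat.ltP/card_setD1.
Qed.

Lemma ls_progress st : ls_inv st -> ls_done st \/ exists st', step st st'.
Proof.
case: st => gen queue todo [/= gU qU dj tf tU cr ce].
have [t0|/set0P[e te]] := eqVneq todo set0; last first.
  right; have [bad|] := pselect (~ feasible e \/ ls_dominated dominates gen queue e).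
    by eexists; apply: LSDiscard te bad.
  by move=> /not_orP[/contrapT fe nd]; eexists; apply: LSInsert te fe nd.
have [q0|/set0P q0] := eqVneq queue set0; first by left.
right; rewrite t0.
have [s qs mins] := argmin_finite key (sub_finite_set qU finU) q0.
by eexists; apply: LSSelect qs mins.
Qed.

Lemma ls_done_root st r : ls_inv st -> ls_done st -> roots r -> feasible r ->
  exists2 l, ls_gen st l & dominates l r.
Proof.
move=> [gU qU dj tf tU cr ce] [q0 t0] rr /(cr _ rr)[l].
by rewrite q0 set0U => gl dl; exists l.
Qed.

Lemma ls_done_ext st l e : ls_inv st -> ls_done st ->
  ls_gen st l -> ~~ complete l -> ext l e -> feasible e ->
  exists2 l', ls_gen st l' & dominates l' e.
Proof.
move=> [gU qU dj tf tU cr ce] [q0 t0] gl nl le fe.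
have [|[l']] := ce l e gl nl le fe; first by rewrite t0.
by rewrite q0 set0U => gl' dl'; exists l'.
Qed.

End LabelSettingTheory.

(** * Linear programming duality *)

Section Farkas.
Variables (R : realFieldType) (K : finType).
Implicit Types (x y : K -> R).

(** The value at [x] of the linear functional with coefficients [y]. *)
Definition dotp y x : R := \sum_k y k * x k.

Lemma dotpDl y1 y2 x : dotp (fun k => y1 k + y2 k) x = dotp y1 x + dotp y2 x.
Proof. by rewrite /dotp -big_split; apply: eq_bigr => k _; rewrite mulrDl. Qed.

Lemma dotpZl a y x : dotp (fun k => a * y k) x = a * dotp y x.
Proof. by rewrite /dotp mulr_sumr; apply: eq_bigr => k _; rewrite mulrA. Qed.

Lemma dotpC y x : dotp y x = dotp x y.
Proof. by apply: eq_bigr => k _; rewrite mulrC. Qed.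

Lemma dotp_sumr (T : Type) (r : seq T) (z : T -> R) (a : T -> K -> R) y :
  dotp y (fun k => \sum_(p <- r) z p * a p k) = \sum_(p <- r) z p * dotp y (a p).
Proof.
rewrite /dotp (eq_bigr (fun k => \sum_(p <- r) z p * (y k * a p k))); last first.
  by move=> k _; rewrite mulr_sumr; apply: eq_bigr => p _; rewrite mulrCA.
by rewrite exchange_big; apply: eq_bigr => p _; rewrite mulr_sumr.
Qed.

(** The lemma of Farkas: a functional that is nonpositive wherever finitely many
    given ones are is a nonnegative combination of them.  The proof is by induction
    on the number of functionals. *)
Lemma farkas (T : eqType) (r : seq T) (a : T -> K -> R) (c : K -> R) :
  uniq r ->
  (forall x, (forall p, p \in r -> dotp (a p) x <= 0) -> dotp c x <= 0) ->
  exists z : T -> R, (forall p, 0 <= z p) /\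
    forall k, \sum_(p <- r) z p * a p k = c k.
Proof.
elim: r a c => [|q r IHr] a c /=.
  move=> _ c0; exists (fun=> 0); split=> // k; rewrite big_nil; apply/esym/eqP.
  have: dotp c c <= 0 by exact: c0.
  have sq i : true -> 0 <= c i * c i by rewrite -expr2 sqr_ge0.
  rewrite le_eqVlt ltNge sumr_ge0// orbF psumr_eq0// => /allP/(_ k).
  by rewrite mem_index_enum mulf_eq0 orbb; exact.
move=> /andP[qr uniq_r] imp.
have [imp'|nimp] := pselect (forall x, (forall p, p \in r -> dotp (a p) x <= 0) ->
                               dotp c x <= 0).
  have [z [z_ge0 zc]] := IHr a c uniq_r imp'.
  exists (fun p => if p == q then 0 else z p); split.
    by move=> p; case: ifP.
  move=> k; rewrite big_cons eqxx mul0r add0r -zc.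
  apply: eq_big_seq => p pr; case: eqP => // pq.
  by move: qr; rewrite -pq pr.
have [x0 [x0r cx0]] : exists x0, (forall p, p \in r -> dotp (a p) x0 <= 0) /\
    0 < dotp c x0.
  apply: contrapT => nex; apply: nimp => x xr; rewrite leNgt; apply/negP => cx.
  by apply: nex; exists x.
have ax0 : 0 < dotp (a q) x0.
  rewrite ltNge; apply/negP => ax0; move: cx0; rewrite ltNge imp// => p.
  by rewrite inE => /orP[/eqP->//|]; exact: x0r.
(* Composing with the projection onto the kernel of a q along x0 makes a q
   vanish. *)
pose pr (f : K -> R) k := f k + - (dotp f x0 / dotp (a q) x0) * a q k.
pose px x k := x k + - (dotp (a q) x / dotp (a q) x0) * x0 k.
have prE f x : dotp (pr f) x = dotp f (px x).
  rewrite [RHS]dotpC /pr /px !dotpDl !dotpZl [dotp x f]dotpC [dotp x0 f]dotpC.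
  by rewrite mulNr mulNr; congr (_ - _); rewrite mulrAC [RHS]mulrAC [X in X / _]mulrC.
have [x xr|z [z_ge0 zE]] := IHr (fun p => pr (a p)) (pr c) uniq_r.
  rewrite prE; apply: imp => p; rewrite inE => /orP[/eqP->|/xr]; last by rewrite prE.
  rewrite -prE /pr dotpDl dotpZl divff ?gt_eqF// mulN1r subrr//.
exists (fun p => if p == q then
    (dotp c x0 - \sum_(p <- r) z p * dotp (a p) x0) / dotp (a q) x0 else z p).
split.
  move=> p; case: ifP => // _; apply: divr_ge0; last exact: ltW.
  rewrite subr_ge0; apply: le_trans (ltW cx0).
  rewrite -oppr_ge0 -sumrN big_seq; apply: sumr_ge0 => {}p pr'.
  by rewrite -mulrN mulr_ge0// oppr_ge0 x0r.
move=> k; rewrite big_cons eqxx.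
rewrite [X in _ + X](eq_big_seq (fun p => z p * a p k)); last first.
  by move=> p pr'; case: eqP => // pq; move: qr; rewrite -pq pr'.
have := zE k; rewrite /pr.
rewrite (eq_bigr (fun p => z p * a p k
    - z p * dotp (a p) x0 * (a q k / dotp (a q) x0))); last first.
  by move=> p _; field; rewrite gt_eqF.
rewrite sumrB -mulr_suml => /eqP.
rewrite subr_eq => /eqP ->; field; rewrite gt_eqF//.
Qed.

End Farkas.

Section StandardForm.
Variables (R : realType) (K : finType) (T : eqType) (r : seq T).
Variables (a : T -> K -> R) (c : T -> R) (v : K -> R).
Hypothesis uniq_r : uniq r.

(** Minimize the sum of [z p * c p] over the columns [p] in [r], subject to
    [lp_primal]; maximize [dotp y v] subject to [lp_dual]. *)
Definition lp_primal (z : T -> R) :=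
  (forall p, 0 <= z p) /\ forall k, \sum_(p <- r) z p * a p k = v k.
Definition lp_dual (y : K -> R) := forall p, p \in r -> dotp y (a p) <= c p.

Lemma lp_weak_duality z y : lp_primal z -> lp_dual y ->
  dotp y v <= \sum_(p <- r) z p * c p.
Proof.
move=> [z0 zv] dy.
have -> : dotp y v = \sum_(p <- r) z p * dotp y (a p).
  by rewrite -dotp_sumr; apply: eq_bigr => k _; rewrite zv.
by rewrite big_seq [leRHS]big_seq; apply: ler_sum => p pr; rewrite ler_wpM2l// dy.
Qed.

(* A vector with an additional coordinate, for costs. *)
Let row (u : K -> R) (w : R) (k : K + 'I_1) : R := if k is inl k then u k else w.

Let dotp_row u w (x : K + 'I_1 -> R) :
  dotp (row u w) x = dotp u (fun k => x (inl k)) + w * x (inr ord0).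
Proof. by rewrite /dotp big_sumType/= big_ord1. Qed.

(** Both existence statements apply [farkas] to the columns extended by their
    costs, the target value being the supremum of the dual values. *)
Lemma lp_strong_duality z0 y0 : lp_primal z0 -> lp_dual y0 ->
  exists z y, [/\ lp_primal z, lp_dual y & \sum_(p <- r) z p * c p <= dotp y v].
Proof.
move=> pz0 dy0.
pose D := [set t | exists2 y, lp_dual y & t = dotp y v].
have ubD z : lp_primal z -> ubound D (\sum_(p <- r) z p * c p).
  by move=> pz _ [y dy ->]; exact: lp_weak_duality.
have supD : has_sup D.
  by split; [exists (dotp y0 v), y0|exists (\sum_(p <- r) z0 p * c p); exact: ubD].
have dual_le y : lp_dual y -> dotp y v <= sup D.
  by move=> dy; apply: (ub_le_sup supD.2); exists y.
have primal_ge z : lp_primal z -> sup D <= \sum_(p <- r) z p * c p.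
  by move=> pz; apply: ge_sup (ubD _ pz); exact: supD.1.
have [z [pz zD]] : exists z, lp_primal z /\ \sum_(p <- r) z p * c p <= sup D.
  pose g (p : option T) := if p is Some p then row (a p) (c p) else row (fun=> 0) 1.
  have [||z [z_ge0 zE]] := @farkas R _ _ (None :: map Some r) g (row v (sup D)).
  - rewrite cons_uniq map_inj_uniq ?uniq_r ?andbT; last by move=> ? ? [].
    by apply/negP => /mapP[].
  - move=> x xg.
    pose y k := x (inl k); pose w := x (inr ord0).
    have w_le0 : w <= 0.
      have := xg None (mem_head _ _); rewrite /g dotp_row mul1r {1}/dotp big1 ?add0r//.
      by move=> k _; rewrite mul0r.
    have ya p : p \in r -> dotp y (a p) + c p * w <= 0.
      move=> pr; have := xg (Some p); rewrite inE (mem_map (@Some_inj _)) pr orbT.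
      by rewrite /g dotp_row dotpC; exact.
    rewrite dotp_row dotpC -/y -/w.
    move: w_le0; rewrite le_eqVlt => /orP[/eqP w0|w_lt0].
      rewrite w0 mulr0 addr0.
      have -> : dotp y v = \sum_(p <- r) z0 p * dotp y (a p).
        by rewrite -dotp_sumr; apply: eq_bigr => k _; rewrite pz0.2.
      rewrite -oppr_ge0 -sumrN big_seq; apply: sumr_ge0 => p pr.
      rewrite -mulrN mulr_ge0// ?pz0.1// oppr_ge0.
      by have := ya p pr; rewrite w0 mulr0 addr0.
    have /dual_le : lp_dual (fun k => (- w)^-1 * y k).
      move=> p pr; rewrite dotpZl mulrC ler_pdivrMr ?oppr_gt0//.
      by have := ya p pr; rewrite mulrN; lra.
    rewrite dotpZl mulrC ler_pdivrMr ?oppr_gt0// mulrN; lra.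
  exists (fun p => z (Some p)); split; first split=> // k.
    have := zE (inl k); rewrite big_cons /= mulr0 add0r big_map/=; exact.
  have := zE (inr ord0); rewrite big_cons /= mulr1 big_map/= => <-.
  by rewrite lerDr.
have [y [dy yD]] : exists y, lp_dual y /\ sup D <= dotp y v.
  apply: contrapT => nex.
  pose g (p : option T) :=
    if p is Some p then row (a p) (c p) else row (fun k => - v k) (- sup D).
  have [||u [u_ge0 uE]] := @farkas R _ _ (None :: map Some r) g (row (fun=> 0) (-1)).
  - rewrite cons_uniq map_inj_uniq ?uniq_r ?andbT; last by move=> ? ? [].
    by apply/negP => /mapP[].
  - move=> x xg.
    pose y k := x (inl k); pose w := x (inr ord0).
    rewrite dotp_row -/w mulN1r {1}/dotp big1 ?add0r; last first.
      by move=> k _; rewrite mul0r.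
    rewrite oppr_le0 leNgt; apply/negP => w_lt0; apply: nex.
    exists (fun k => (- w)^-1 * y k); split.
      move=> p pr; rewrite dotpZl mulrC ler_pdivrMr ?oppr_gt0//.
      have := xg (Some p); rewrite inE (mem_map (@Some_inj _)) pr orbT.
      rewrite /g dotp_row dotpC -/y -/w => /(_ isT); rewrite mulrN; lra.
    rewrite dotpZl mulrC ler_pdivlMr ?oppr_gt0//.
    have := xg None (mem_head _ _); rewrite /g dotp_row -/w.
    have -> : dotp (fun k => - v k) (fun k => x (inl k)) = - dotp y v.
      by rewrite dotpC /dotp -sumrN; apply: eq_bigr => k _; rewrite mulrN.
    rewrite mulrN; lra.
  pose s := u None; pose z' p := u (Some p).
  have z'v k : \sum_(p <- r) z' p * a p k = s * v k.
    have := uE (inl k); rewrite big_cons /= big_map/= mulrN -/s => /eqP.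
    by rewrite addrC subr_eq0 => /eqP.
  have z'c : \sum_(p <- r) z' p * c p = s * sup D - 1.
    have := uE (inr ord0); rewrite big_cons /= big_map/= mulrN -/s => /eqP.
    by rewrite addrC subr_eq addrC => /eqP.
  have : 0 <= s := u_ge0 None.
  rewrite le_eqVlt => /orP[/eqP s0|s_gt0].
    have : \sum_(p <- r) z' p * dotp y0 (a p) <= \sum_(p <- r) z' p * c p.
      rewrite big_seq [leRHS]big_seq; apply: ler_sum => p pr.
      by apply: ler_wpM2l; [exact: u_ge0|exact: dy0].
    have -> : \sum_(p <- r) z' p * dotp y0 (a p) = 0.
      rewrite -dotp_sumr /dotp big1// => k _.
      by rewrite z'v -s0 mul0r mulr0.
    rewrite z'c -s0; lra.
  have /primal_ge : lp_primal (fun p => s^-1 * z' p).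
    split=> [p|k]; first by apply: mulr_ge0; [rewrite invr_ge0 ltW|exact: u_ge0].
    rewrite (eq_bigr (fun p => s^-1 * (z' p * a p k))) => [|p _]; last by rewrite mulrA.
    by rewrite -mulr_sumr z'v mulKf// gt_eqF.
  rewrite (eq_bigr (fun p => s^-1 * (z' p * c p))) => [|p _]; last by rewrite mulrA.
  rewrite -mulr_sumr z'c mulrC ler_pdivlMr// mulrC; lra.
by exists z, y; split=> //; exact: le_trans zD yD.
Qed.

End StandardForm.

(** * The charging function *)

Section Recharge.
Variables (R : realType) (I : instance R).
Let g := recharge I.
Let h := recharge_inv I.
Let Bat := battery I.

Lemma battery_ge0 : 0 <= Bat.
Proof. by have /andP[] := recharge_range I (lexx 0); exact: le_trans. Qed.

Lemma recharge_le t : 0 <= t -> g t <= Bat.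
Proof. by move=> /(recharge_range I)/andP[]. Qed.

Lemma recharge_ivt x y v : 0 <= x -> x <= y -> g x <= v <= g y ->
  exists2 t, x <= t <= y & g t = v.
Proof.
move=> x0 xy /andP[xv vy].
have cg : {within `[x, y], continuous g}.
  apply: (continuous_subspaceW _ (@recharge_continuous R I)) => t /=.
  by rewrite in_itv/= => /andP[+ _]; exact: le_trans.
have [|t txy gt] := @IVT R g x y v xy cg.
  by rewrite ge_min xv /= le_max vy orbT.
by exists t => //; move: txy; rewrite in_itv.
Qed.

Lemma recharge_invP b : 0 <= b <= Bat -> 0 <= h b /\ g (h b) = b.
Proof.
move=> /andP[b0 bB].
pose A := [set t : R | 0 <= t /\ g t = b].
have [T0 T0_ge0 gT0] := recharge_full I.
have [t1 /andP[t1_ge0 _] gt1] : exists2 t, 0 <= t <= T0 & g t = b.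
  by apply: recharge_ivt => //; rewrite /g recharge0 gT0 b0.
have At1 : A t1 by [].
have lbA : lbound A 0 by move=> t [].
have infA : has_inf A by split; [exists t1|exists 0].
have h0 : 0 <= h b by apply: lb_le_inf => //; exists t1.
split=> //.
have ht1 : h b <= t1 by exact: (ge_inf infA.2 At1).
have gh_le : g (h b) <= b by rewrite -[leRHS]gt1; exact: recharge_nondecreasing.
apply/eqP; rewrite eq_le gh_le /= leNgt; apply/negP => gh_lt.
(* A level strictly between g (h b) and b is reached at a lower bound of the
   set whose infimum is h b. *)
pose v := (g (h b) + b) / 2.
have [t /andP[ht tt1] gt] : exists2 t, h b <= t <= t1 & g t = v.
  by apply: recharge_ivt => //; rewrite gt1 /v; apply/andP; split; lra.
have : t <= h b.
  apply: lb_le_inf; first by exists t1.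
  move=> t2 [t2_ge0 gt2]; rewrite leNgt; apply/negP => t2t.
  have := recharge_nondecreasing I t2_ge0 (ltW t2t); rewrite gt2 -/g gt /v; lra.
move=> th; have tE : t = h b by apply/le_anti; rewrite th ht.
by move: gt; rewrite tE /v; lra.
Qed.

Lemma recharge_inv_ge0 b : 0 <= b <= Bat -> 0 <= h b.
Proof. by move=> /recharge_invP[]. Qed.

Lemma recharge_invK b : 0 <= b <= Bat -> g (h b) = b.
Proof. by move=> /recharge_invP[]. Qed.

Lemma recharge_inv_mono b1 b2 : 0 <= b1 -> b1 <= b2 -> b2 <= Bat -> h b1 <= h b2.
Proof.
move=> b1_ge0 b12 b2B; rewrite leNgt; apply/negP => h21.
have [h1 gh1] : 0 <= h b1 /\ g (h b1) = b1.
  by apply: recharge_invP; rewrite b1_ge0 (le_trans b12).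
have [h2 gh2] : 0 <= h b2 /\ g (h b2) = b2.
  by apply: recharge_invP; rewrite b2B (le_trans b1_ge0).
have := recharge_nondecreasing I h2 (ltW h21); rewrite -/g gh1 gh2 => b21.
have b12E : b1 = b2 by apply/le_anti; rewrite b12.
by move: h21; rewrite b12E ltxx.
Qed.

Lemma recharge_inv_le b t : 0 <= b -> 0 <= t -> b <= g t -> h b <= t.
Proof.
move=> b0 t0 bgt; apply: le_trans (recharge_inv_mono b0 bgt (recharge_le t0)) _.
have lb0 : has_lbound [set t' : R | 0 <= t' /\ g t' = g t] by exists 0 => x [].
by apply: (ge_inf lb0).
Qed.

(** An empty battery charged for a time [t] has at least the level [b] if and only
    if [recharge_inv I b <= t]. *)
Lemma recharge_inv_gal b t : 0 <= b <= Bat -> 0 <= t -> (b <= g t) = (h b <= t).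
Proof.
move=> bB t0; apply/idP/idP; first by apply: recharge_inv_le => //; case/andP: bB.
move=> hbt; rewrite -(recharge_invK bB); apply: recharge_nondecreasing => //.
exact: recharge_inv_ge0.
Qed.

(** Charging for a given time adds at least as much energy at a lower level. *)
Lemma recharge_increment x y d : 0 <= x -> x <= y -> 0 <= d ->
  g (y + d) - g y <= g (x + d) - g x.
Proof.
move=> x0 xy d0.
have [->|xNy] := eqVneq x y; first by [].
have yx : 0 < y - x by rewrite subr_gt0 lt_neqAle xNy.
(* y = (1 - a) x + a (y + d) and x + d = a x + (1 - a) (y + d). *)
pose a := (y - x) / (y - x + d).
have den : 0 < y - x + d by lra.
have a01 : 0 <= a <= 1.
  apply/andP; split; first by apply: divr_ge0; exact: ltW.
  by rewrite /a ler_pdivrMr// mul1r lerDl.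
have a01' : 0 <= 1 - a <= 1 by case/andP: a01 => ? ?; apply/andP; split; lra.
have yd0 : 0 <= y + d by lra.
have := recharge_concave I x0 yd0 a01.
have := recharge_concave I x0 yd0 a01'.
have -> : (1 - a) * x + (1 - (1 - a)) * (y + d) = y.
  by rewrite /a; field; rewrite gt_eqF.
have -> : a * x + (1 - a) * (y + d) = x + d.
  by rewrite /a; field; rewrite gt_eqF.
rewrite -/g; lra.
Qed.

Lemma g_C0 b : 0 <= b <= Bat -> g_C I b 0 = b.
Proof. by move=> bB; rewrite /g_C addr0 -/g recharge_invK. Qed.

Lemma g_C_range b t : 0 <= b <= Bat -> 0 <= t -> 0 <= g_C I b t <= Bat.
Proof.
by move=> bB t0; apply: recharge_range; rewrite addr_ge0// recharge_inv_ge0.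
Qed.

End Recharge.

(** * Subpaths *)

Section Run.
Variables (A St : Type) (ok : A -> St -> Prop) (next : A -> A -> St -> St -> Prop).

(** A run along the nonempty sequence [x :: q], from the state [s] at [x] to the
    state [s'] at its last element: every element accepts its state and consecutive
    states are related by [next]. *)
Fixpoint run (x : A) (q : seq A) (s s' : St) : Prop :=
  ok x s /\ if q is y :: q' then exists2 s1, next x y s s1 & run y q' s1 s'
            else s' = s.

Lemma runP x q s s' : run x q s s' <->
  exists f : nat -> St, [/\ f 0%N = s, f (size q) = s',
    forall k, (k < size q)%N ->
      next (nth x (x :: q) k) (nth x (x :: q) k.+1) (f k) (f k.+1) &
    forall k, (k <= size q)%N -> ok (nth x (x :: q) k) (f k)].
Proof.
split; elim: q x s => [|y q IHq] x s /=.
- move=> [okx ->]; exists (fun=> s); split=> // k.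
  by rewrite leqn0 => /eqP->.
- move=> [okx [s1 xy /IHq[f [f0 fn nextf okf]]]].
  exists (fun k => if k is k'.+1 then f k' else s); split=> //=.
  + move=> [|k] kq /=; first by rewrite f0.
    by rewrite !(set_nth_default y)//=; [exact: (nextf k kq)|lia].
  + by move=> [|k] kq //=; rewrite (set_nth_default y)//; exact: okf.
- by move=> [f [<- <- _ okf]]; split=> //; exact: (okf 0%N).
- move=> [f [<- fn nextf okf]]; split; first exact: (okf 0%N).
  exists (f 1%N); first exact: (nextf 0%N).
  apply: IHq; exists (f \o S); split=> //= k kq.
    by have := nextf k.+1 kq; rewrite /= !(set_nth_default y)//=; lia.
  by have := okf k.+1 kq; rewrite /= !(set_nth_default y).
Qed.

Lemma run_cat x q1 q2 s s' : run x (q1 ++ q2) s s' <->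
  exists2 s1, run x q1 s s1 & run (last x q1) q2 s1 s'.
Proof.
elim: q1 x s => [|y q1 IHq] x s /=.
  split; last by move=> [s1 [? ->]].
  by move=> r; exists s => //; split=> //; case: q2 r => [|? ?] /= [].
split.
  by move=> [okx [s1 n1 /IHq[s2 r1 r2]]]; exists s2 => //; split=> //; exists s1.
move=> [s2 [okx [s1 n1 r1]] r2]; split=> //; exists s1 => //; apply/IHq.
by exists s2.
Qed.

Lemma run_head x q s s' : run x q s s' -> ok x s.
Proof. by case: q => [|y q] /= []. Qed.

Lemma run_last x q s s' : run x q s s' -> ok (last x q) s'.
Proof. by elim: q x s => [|y q IHq] x s /= [okx]; [move=> ->|move=> [s1 _ /IHq]]. Qed.

End Run.

Section Sequences.
Variables (R : realType) (I : instance R).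
Implicit Types (i j : I) (q : seq I) (s : nodeseq I).

Lemma arc_sum0 (f : I -> I -> R) i : arc_sum f (i, [::]) = 0.
Proof. by rewrite /arc_sum /arcs /= big_nil. Qed.

Lemma arc_sum_cons (f : I -> I -> R) i j q :
  arc_sum f (i, j :: q) = f i j + arc_sum f (j, q).
Proof. by rewrite /arc_sum /arcs /= big_cons. Qed.

Lemma arc_sum_cat (f : I -> I -> R) i q1 q2 :
  arc_sum f (i, q1 ++ q2) = arc_sum f (i, q1) + arc_sum f (last i q1, q2).
Proof.
elim: q1 i => [|k q1 IHq] i /=; first by rewrite arc_sum0 add0r.
by rewrite !arc_sum_cons IHq addrA.
Qed.

Lemma arc_sum_rcons (f : I -> I -> R) i q j :
  arc_sum f (i, rcons q j) = arc_sum f (i, q) + f (last i q) j.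
Proof. by rewrite -cats1 arc_sum_cat arc_sum_cons arc_sum0 addr0. Qed.

Lemma load_cat i q1 q2 :
  load (i, q1 ++ q2) = load (i, q1) + \sum_(k <- q2) demand k.
Proof. by rewrite /load /nodes /= -cat_cons big_cat. Qed.

Lemma load_rcons i q j : load (i, rcons q j) = load (i, q) + demand j.
Proof. by rewrite -cats1 load_cat big_seq1. Qed.

(** The inner nodes of a path or subpath, its two end nodes being left out. *)
Lemma interiorP (P : pred I) s :
  (forall k, (0 < k < size s.2)%N -> P (node_at s k)) <->
  all P (behead (belast s.1 s.2)).
Proof.
case: s => i [|j q]; first by split=> // _ [|k] //=; rewrite andbF.
have nthE k : (k < size q)%N -> nth i (belast j q) k = nth i (j :: q) k.
  by move=> kq; rewrite (lastI j q) nth_rcons size_belast kq.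
rewrite /node_at /nodes /=; split.
  move=> Pk; apply/(all_nthP i) => k; rewrite size_belast => kq.
  by rewrite nthE//; apply: (Pk k.+1).
move=> /(all_nthP i) Pk [//|k] /= kq; rewrite ltnS in kq.
by rewrite -nthE//; apply: Pk; rewrite size_belast.
Qed.

Lemma all_last (P : pred I) i q : all P q -> q != [::] -> P (last i q).
Proof.
by case/lastP: q => // q k; rewrite last_rcons all_rcons => /andP[].
Qed.

Lemma all_interior (P : pred I) i q :
  all P (behead (belast i q)) -> P (last i q) -> all P q.
Proof.
by case/lastP: q => // q k; rewrite belast_rcons last_rcons all_rcons => -> ->.
Qed.

Lemma horizon_ge0 i : 0 <= horizon I.
Proof. by have [a0 [ab bT]] := tw_sub i; apply: le_trans bT; exact: le_trans ab. Qed.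

Lemma close_le_horizon i : tw_close i <= horizon I.
Proof. by have [? []] := tw_sub i. Qed.

Lemma open_ge0 i : 0 <= tw_open i.
Proof. by have [] := tw_sub i. Qed.

Lemma open_le_close i : tw_open i <= tw_close i.
Proof. by have [? []] := tw_sub i. Qed.

Lemma facilityP i : is_depot i || is_station i ->
  [/\ demand i = 0, tw_open i = 0 & tw_close i = horizon I].
Proof.
move=> fi; apply: facility_trivial => ki.
by move: fi; rewrite /is_depot /is_station ki.
Qed.

Lemma kindP i : [\/ is_customer i, is_depot i | is_station i].
Proof.
by rewrite /is_customer /is_depot /is_station; case: (kind i); constructor.
Qed.

Lemma customerN i : is_customer i -> ~~ is_depot i /\ ~~ is_station i.
Proof. by rewrite /is_customer /is_depot /is_station; case: (kind i). Qed.

Lemma depotN i : is_depot i -> ~~ is_customer i /\ ~~ is_station i.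
Proof. by rewrite /is_customer /is_depot /is_station; case: (kind i). Qed.

Lemma stationN i : is_station i -> ~~ is_customer i /\ ~~ is_depot i.
Proof. by rewrite /is_customer /is_depot /is_station; case: (kind i). Qed.

Lemma arc_sum_ge0 (f : I -> I -> R) i q :
  (forall i j, is_arc i j -> 0 < f i j) -> path (@is_arc R I) i q ->
  0 <= arc_sum f (i, q).
Proof.
move=> f_gt0; elim: q i => [|j q IHq] i /=; first by rewrite arc_sum0.
by move=> /andP[ij /IHq qp]; rewrite arc_sum_cons addr_ge0// ltW// f_gt0.
Qed.

Lemma arc_sum_gt0 (f : I -> I -> R) i q :
  (forall i j, is_arc i j -> 0 < f i j) -> path (@is_arc R I) i q ->
  q != [::] -> 0 < arc_sum f (i, q).
Proof.
move=> f_gt0; case: q => [//|j q] /= /andP[ij qp] _.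
by rewrite arc_sum_cons ltr_pwDl ?f_gt0//; exact: arc_sum_ge0.
Qed.

(** ** Time windows along a sequence *)

(** Leaving [i] at time [t] and going through [q] without charging meets all the
    deadlines, that of [i] included. *)
Fixpoint tw_ok (t : R) i q : bool :=
  (t <= tw_close i) &&
  if q is j :: q' then tw_ok (Num.max (t + time i j) (tw_open j)) j q' else true.

Lemma tw_ok_close t i q : tw_ok t i q -> t <= tw_close i.
Proof. by case: q => [|j q] /= /andP[]. Qed.

Lemma tw_ok_le t t' i q : t <= t' -> tw_ok t' i q -> tw_ok t i q.
Proof.
elim: q i t t' => [|j q IHq] i t t' tt' /=; first by rewrite !andbT; exact: le_trans.
move=> /andP[t'i okq]; rewrite (le_trans tt' t'i) /=; apply: IHq okq.
by rewrite ge_max !le_max lerD2r tt' lexx orbT.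
Qed.

Lemma tw_ok_latest t i q : tw_ok t i q -> t <= latest_start i q.
Proof.
elim: q i t => [|j q IHq] i t /=; first by rewrite andbT.
move=> /andP[ti /IHq]; rewrite le_min ti andbT ge_max => /andP[+ _].
by rewrite lerBrDr.
Qed.

(** The backward recursion of [latest_start] ignores the opening times; the run
    from [t0] takes care of them. *)
Lemma latest_tw_ok t0 t i q : tw_ok t0 i q -> t <= latest_start i q -> tw_ok t i q.
Proof.
elim: q i t t0 => [|j q IHq] i t t0 /=; first by rewrite !andbT.
move=> /andP[t0i okq]; rewrite le_min => /andP[tL ->] /=.
apply: (IHq _ _ _ okq); rewrite ge_max -lerBrDr tL /=.
by have := tw_ok_latest okq; rewrite ge_max => /andP[].
Qed.

Lemma tw_ok_rcons t i q j :
  tw_ok t i (rcons q j) = tw_ok t i q && (end_time_from t i (rcons q j) <= tw_close j).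
Proof.
elim: q i t => [|k q IHq] i t /=; first by rewrite !andbT.
by rewrite IHq andbA.
Qed.

Lemma end_time_from_rcons t i q j :
  end_time_from t i (rcons q j)
    = Num.max (end_time_from t i q + time (last i q) j) (tw_open j).
Proof. by elim: q i t => [|k q IHq] i t //=; rewrite IHq. Qed.

Lemma end_time_from_ge t i q : t + arc_sum (@time R I) (i, q) <= end_time_from t i q.
Proof.
elim: q i t => [|k q IHq] i t /=; first by rewrite arc_sum0 addr0.
rewrite arc_sum_cons; apply: le_trans (IHq _ _).
by rewrite addrA lerD2r le_max lexx.
Qed.

(** The end time of a sequence depends on its start time [t] only through the
    total travel time and the end time from any earlier start [t0]. *)
Lemma end_time_fromE t0 t i q : t0 <= t ->
  end_time_from t i q
    = Num.max (t + arc_sum (@time R I) (i, q)) (end_time_from t0 i q).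
Proof.
elim: q i t0 t => [|k q IHq] i t0 t t0t /=.
  by rewrite arc_sum0 addr0 (max_idPl t0t).
rewrite (IHq k (Num.max (t0 + time i k) (tw_open k))); last first.
  by rewrite ge_max !le_max lerD2r t0t lexx orbT.
rewrite arc_sum_cons addrA addr_maxl -maxA; congr Num.max; apply/max_idPr.
apply: le_trans (end_time_from_ge _ _ _).
by rewrite lerD2r le_max lexx orbT.
Qed.

Lemma latest_start_rcons i q j :
  latest_start i (rcons q j) =
  Num.min (tw_close j - time (last i q) j - arc_sum (@time R I) (i, q))
          (latest_start i q).
Proof.
elim: q i => [|k q IHq] i /=; first by rewrite arc_sum0 subr0.
by rewrite IHq addr_minl -minA arc_sum_cons; congr Num.min; ring.
Qed.

Lemma latest_start_close i q : latest_start i q <= tw_close i.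
Proof. by case: q => [|j q] //=; rewrite ge_min lexx orbT. Qed.

(** ** Feasible subpaths *)

(** Without charging, a run exists as soon as the energy suffices for all arcs and
    all the deadlines are met. *)
Lemma run_deterministicP i q t b t' b' :
  path (@is_arc R I) i q ->
  run (fun i (tb : R * R) => 0 <= tb.2 <= battery I /\
                             tw_open i <= tb.1 <= tw_close i)
      (fun i j tb tb' => tb'.1 = Num.max (tb.1 + time i j) (tw_open j) /\
                         tb'.2 = tb.2 - energy i j) i q (t, b) (t', b') <->
  [/\ b <= battery I, arc_sum (@energy R I) (i, q) <= b & tw_open i <= t] /\
  [/\ tw_ok t i q, t' = end_time_from t i q & b' = b - arc_sum (@energy R I) (i, q)].
Proof.
elim: q i t b => [|j q IHq] i t b /=.
  rewrite arc_sum0 subr0 andbT => _; split.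
    by move=> [[/andP[-> ->] /andP[-> ->]] [-> ->]].
  by move=> [[-> -> ->] [-> -> ->]].
move=> /andP[ij qp]; have eij := energy_gt0 ij.
have eq0 : 0 <= arc_sum (@energy R I) (j, q).
  by apply: arc_sum_ge0 qp; exact: energy_gt0.
rewrite arc_sum_cons; split.
  move=> [[/andP[b0 bB] /andP[ti ti']] [[_ _] /= [-> ->] /(IHq _ _ _ qp)]].
  move=> [[bB' eb _] [okq -> ->]]; split; split=> //.
  - by rewrite addrC -lerBrDr.
  - by rewrite ti' okq.
  - by rewrite opprD addrA.
move=> [[bB eb ti] [/andP[ti' okq] t'E b'E]]; split.
  by rewrite bB ti ti' (le_trans _ eb)// addr_ge0// ltW.
exists (Num.max (t + time i j) (tw_open j), b - energy i j) => //.
apply/(IHq _ _ _ qp); split; split=> //.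
- by rewrite lerBlDr (le_trans bB)// lerDl ltW.
- by rewrite lerBrDr addrC.
- by rewrite le_max lexx orbT.
- by rewrite b'E opprD addrA.
Qed.

Lemma feasible_subpathE s : feasible_subpath s <->
  [/\ partial_subpath s, load s <= capacity I, battery_use s <= battery I &
      tw_ok (tw_open s.1) s.1 s.2].
Proof.
case: s => i q; split.
  move=> [ps [t [b [next lc ok]]]]; have [arcs_q _ _] := ps.
  have : run (fun i (tb : R * R) => 0 <= tb.2 <= battery I /\
                             tw_open i <= tb.1 <= tw_close i)
      (fun i j tb tb' => tb'.1 = Num.max (tb.1 + time i j) (tw_open j) /\
                         tb'.2 = tb.2 - energy i j) i q
      (t 0%N, b 0%N) (t (size q), b (size q)).
    by apply/runP; exists (fun k => (t k, b k)); split=> // k /next.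
  move=> /(run_deterministicP _ _ _ _ arcs_q)[[bB eb ti] [okq _ _]].
  by split=> //; [exact: le_trans bB|exact: tw_ok_le okq].
move=> [ps lc eB okq]; split=> //; have [arcs_q _ _] := ps.
have /runP[f [f0 fn next ok]] :=
    (run_deterministicP (tw_open i) (battery I) (end_time_from (tw_open i) i q)
      (battery I - arc_sum (@energy R I) (i, q)) arcs_q).2
    (conj (And3 (lexx _) eB (lexx _)) (And3 okq erefl erefl)).
exists (fun k => (f k).1), (fun k => (f k).2).
by split.
Qed.

Lemma partial_subpathE s : partial_subpath s <->
  [/\ along_arcs s, is_depot s.1 || is_station s.1 &
      all (@is_customer R I) (behead (belast s.1 s.2))].
Proof.
by split=> -[? ? inner]; split=> //; [exact/interiorP|apply/(interiorP _ s)].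
Qed.

Lemma partial_subpath_rcons i q j : partial_subpath (i, rcons q j) <->
  [/\ path (@is_arc R I) i q, is_arc (last i q) j, is_depot i || is_station i &
      all (@is_customer R I) q].
Proof.
split.
  move=> /partial_subpathE[].
  by rewrite /along_arcs /= rcons_path belast_rcons => /andP[].
move=> [qp qj fi cq]; apply/partial_subpathE; split=> //.
  by rewrite /along_arcs /= rcons_path qp.
by rewrite belast_rcons.
Qed.

Lemma partial_subpath_prefix i q j :
  partial_subpath (i, rcons q j) -> partial_subpath (i, q).
Proof.
move=> /partial_subpath_rcons[qp qj fi cq]; apply/partial_subpathE; split=> //=.
case: q cq {qp qj} => // k q; rewrite [k :: q in X in X -> _]lastI all_rcons.
by case/andP.
Qed.

Lemma feasible_subpath_rcons i q j : feasible_subpath (i, rcons q j) <->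
  [/\ feasible_subpath (i, q), partial_subpath (i, rcons q j),
     load (i, q) + demand j <= capacity I,
     battery_use (i, q) + energy (last i q) j <= battery I &
     sub_end_min (i, rcons q j) <= tw_close j].
Proof.
have loadE := load_rcons i q j; have batE := arc_sum_rcons (@energy R I) i q j.
split.
  move=> /feasible_subpathE[ps lc eB]; rewrite /= tw_ok_rcons => /andP[okq eT].
  rewrite -loadE /battery_use -batE; split=> //; apply/feasible_subpathE; split=> //.
  - exact: partial_subpath_prefix ps.
  - by apply: le_trans lc; rewrite loadE lerDl demand_ge0.
  - apply: le_trans eB; rewrite /battery_use batE lerDl ltW//; apply: energy_gt0.
    by case/partial_subpath_rcons: ps.
move=> [/feasible_subpathE[_ _ _ okq] ps lc eB eT]; apply/feasible_subpathE.
rewrite loadE /battery_use batE; split=> //.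
by rewrite /= tw_ok_rcons; apply/andP.
Qed.

Lemma feasible_start_max s : feasible_subpath s ->
  tw_open s.1 <= sub_start_max s <= horizon I.
Proof.
move=> /feasible_subpathE[_ _ _ okq]; rewrite tw_ok_latest//=.
exact: le_trans (latest_start_close _ _) (close_le_horizon _).
Qed.

(** ** Domination between subpaths *)

Lemma subpath_dominates_refl y s : feasible_subpath s -> subpath_dominates y s s.
Proof. by []. Qed.

Lemma subpath_dominates_trans y s1 s2 s3 :
  subpath_dominates y s1 s2 -> subpath_dominates y s2 s3 -> subpath_dominates y s1 s3.
Proof.
move=> [[f1 _] [a1 a2] a3 [a4 a5] [a6 a7 a8]] [[_ f3] [b1 b2] b3 [b4 b5] [b6 b7 b8]].
split; first by [].
- by rewrite a1 a2.
- exact: le_trans b3.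
- by split; [exact: le_trans b4|exact: le_trans b5].
- by split; [exact: le_trans b6|exact: le_trans a7|exact: le_trans b8].
Qed.

(** Travel times need not be ordered by domination, but the comparison of the
    durations bounds that of the dominating subpath. *)
Lemma dominates_travel_time y s1 s2 : subpath_dominates y s1 s2 ->
  travel_time s1 <= travel_time s2 \/
  travel_time s1 <= sub_end_min s2 - sub_start_max s2.
Proof.
move=> [_ _ _ _ [_ _]]; rewrite /sub_duration ge_max => /andP[].
by rewrite le_max => /orP.
Qed.

(** A subpath without arcs uses no energy, so it is dominated by itself only. *)
Lemma subpath_dominates_root y s1 s2 : subpath_dominates y s1 s2 ->
  s2.2 = [::] -> s1 = s2.
Proof.
case: s1 s2 => [i1 q1] [i2 q2].
move=> [[/feasible_subpathE[ps1 _ _ _] _] [/= i12 _] _ [_ eB] _] q20.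
rewrite {}i12 in ps1 eB *.
move: eB; rewrite q20 /battery_use arc_sum0.
have [->//|q1N0] := eqVneq q1 [::]; rewrite leNgt arc_sum_gt0//.
  exact: energy_gt0.
by case: ps1.
Qed.

Lemma subpath_dominates_rcons y s1 s2 j : subpath_dominates y s1 s2 ->
  feasible_subpath (s2.1, rcons s2.2 j) ->
  subpath_dominates y (s1.1, rcons s1.2 j) (s2.1, rcons s2.2 j).
Proof.
move=> dom feas2j; have root := subpath_dominates_root dom.
have tt := dominates_travel_time dom.
case: s1 s2 => [i1 q1] [i2 q2] in dom feas2j root tt *.
have [[feas1 feas2] [/= iE lastE] rc [lo eB] [Emin Smax _]] := dom.
rewrite {}iE in dom feas1 lastE rc lo eB Emin Smax root tt *.
rewrite /end_node /= in lastE.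
have /feasible_subpath_rcons[_ ps2j lc2 eB2 eT2] := feas2j.
have [qp2 arc2 fi cq2] := (partial_subpath_rcons _ _ _).1 ps2j.
have {}lo : load (i2, q1) <= load (i2, q2) by [].
rewrite /sub_end_min /= in Emin eT2 tt; rewrite /sub_start_max /= in Smax tt.
have EminR : end_time_from (tw_open i2) i2 (rcons q1 j)
    <= end_time_from (tw_open i2) i2 (rcons q2 j).
  by rewrite !end_time_from_rcons lastE ge_max !le_max lerD2r Emin lexx orbT.
have arrive : end_time_from (tw_open i2) i2 q2 + time (last i2 q2) j <= tw_close j.
  by apply: le_trans eT2; rewrite end_time_from_rcons le_max lexx.
have feas1j : feasible_subpath (i2, rcons q1 j).
  apply/feasible_subpath_rcons; split=> //.
  - apply/partial_subpath_rcons; rewrite lastE; split=> //.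
      by case/feasible_subpathE: feas1 => -[].
    have [q20|/eqP q2N0] := pselect (q2 = [::]).
      by case: (root q20) => ->; rewrite q20.
    have [->//|q1N0] := eqVneq q1 [::].
    have /feasible_subpathE[/partial_subpathE[_ _ cq1] _ _ _] := feas1.
    by apply: all_interior cq1 _; rewrite lastE; exact: all_last.
  - by apply: le_trans lc2; rewrite lerD2r.
  - by apply: le_trans eB2; rewrite lastE lerD2r.
  - exact: le_trans EminR eT2.
have SmaxR : latest_start i2 (rcons q2 j) <= latest_start i2 (rcons q1 j).
  rewrite !latest_start_rcons lastE le_min !ge_min Smax orbT andbT.
  apply/orP; case: tt => tt; [left|right]; rewrite /travel_time in tt; lra.
split=> //=.
- by split=> //; rewrite /end_node /= !last_rcons.
- by rewrite !arc_sum_rcons lastE lerD2r.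
- by rewrite !load_rcons /battery_use !arc_sum_rcons lastE !lerD2r.
- split=> //; rewrite /sub_duration ge_max !le_max /sub_end_min /sub_start_max /=.
  rewrite (lerB EminR SmaxR) orbT andbT /travel_time !arc_sum_rcons lastE lerD2r.
  apply/orP; case: tt => tt; [by left|right]; rewrite /travel_time in tt.
  have : latest_start i2 (rcons q2 j) <= latest_start i2 q2.
    by rewrite latest_start_rcons ge_min lexx orbT.
  have : end_time_from (tw_open i2) i2 q2 + time (last i2 q2) j
      <= end_time_from (tw_open i2) i2 (rcons q2 j).
    by rewrite end_time_from_rcons le_max lexx.
  lra.
Qed.

End Sequences.

(** * Path labels *)

Section Labels.
Variables (R : realType) (I : instance R).
Implicit Types (i j : I) (q : seq I) (s : nodeseq I) (ss : seq (nodeseq I)).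
Implicit Types (l : plabel I) (t b u : R).
Let Bat := battery I.

(** ** Runs of a vehicle through nodes *)

(** The state of a vehicle at a node is its arrival time and its energy level on
    arrival. *)
Definition node_ok i (tb : R * R) : Prop :=
  0 <= tb.2 <= battery I /\ tw_open i <= tb.1 <= tw_close i.

(** Charging for a time [tau], which vanishes outside stations, and traversing an
    arc.  If [tau] vanishes, then [g_C] leaves any level of the battery as it is. *)
Definition node_next i j (tb tb' : R * R) : Prop :=
  exists tau, [/\ 0 <= tau, ~~ is_station i -> tau = 0,
    tb'.1 = Num.max (tb.1 + tau + time i j) (tw_open j) &
    tb'.2 = g_C I tb.2 tau - energy i j].

Let det_next i j (tb tb' : R * R) : Prop :=
  tb'.1 = Num.max (tb.1 + time i j) (tw_open j) /\ tb'.2 = tb.2 - energy i j.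

Lemma feasible_partial_pathE p : feasible_partial_path p <->
  [/\ partial_path p, load p <= capacity I &
      exists tb, run node_ok node_next p.1 p.2 (0, battery I) tb].
Proof.
case: p => i q; split.
  move=> [pp [tau [t [b [[tau0 tauN] [t0 b0] next lc ok]]]]]; split=> //.
  exists (t (size q), b (size q)); apply/runP; exists (fun k => (t k, b k)).
  split=> //=; first by rewrite t0 b0.
  move=> k kq; have [tE bE] := next k kq; have [bB _] := ok k (ltnW kq).
  exists (tau k); split=> //=; first exact: (tauN k (ltnW kq)).
  rewrite bE /node_at /=; case: ifP => // /negbT nst.
  by rewrite (tauN k (ltnW kq) nst) g_C0.
move=> [pp lc [tb /runP[f [f0 fn next ok]]]]; split=> //.
pose n_ k := node_at (i, q) k.
have /choice[tau tauP] : forall k, exists tau, [/\ 0 <= tau,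
    ((k <= size q)%N -> ~~ is_station (n_ k) -> tau = 0) &
    (k < size q)%N ->
      (f k.+1).1 = Num.max ((f k).1 + tau + time (n_ k) (n_ k.+1)) (tw_open (n_ k.+1)) /\
      (f k.+1).2 = g_C I (f k).2 tau - energy (n_ k) (n_ k.+1)].
  move=> k; have [kq|kq] := ltnP k (size q).
    by have [tau [tau0 tauN tE bE]] := next k kq; exists tau; split.
  by exists 0; split.
exists tau, (fun k => (f k).1), (fun k => (f k).2); split=> //.
- by split=> k; have [] := tauP k.
- by rewrite f0.
- move=> k kq; have [_ tauN /(_ kq)[-> ->]] := tauP k; split=> //.
  case: ifP => // /negbT nst; rewrite (tauN (ltnW kq) nst) g_C0//.
  by have [] := ok k (ltnW kq).
Qed.

Lemma node_run_det i q tb tb' : all (fun k => ~~ is_station k) (belast i q) ->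
  run node_ok node_next i q tb tb' <-> run node_ok det_next i q tb tb'.
Proof.
elim: q i tb => [|j q IHq] i tb //= /andP[nst nstq].
split=> -[ok [tb1 nx r]]; split=> //; exists tb1 => //; try exact/IHq.
- case: nx => tau [_ /(_ nst)-> tE bE].
  by rewrite /det_next tE bE addr0 g_C0//; case: ok.
- case: nx => tE bE; exists 0; split=> //; first by rewrite addr0.
  by rewrite g_C0//; case: ok.
Qed.

(** Going through the complete subpath [s] after reaching its first node at
    time [t] with energy [b], and charging there first. *)
Definition lstep s t b t' b' : Prop :=
  exists tau, [/\ 0 <= tau, ~~ is_station s.1 -> tau = 0,
    t + tau <= sub_start_max s, battery_use s <= g_C I b tau &
    t' = Num.max (t + tau + travel_time s) (sub_end_min s) /\
    b' = g_C I b tau - battery_use s].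

Lemma subpath_runP s tb t' b' : feasible_subpath s -> complete_subpath s ->
  node_ok s.1 tb ->
  run node_ok node_next s.1 s.2 tb (t', b') <-> lstep s tb.1 tb.2 t' b'.
Proof.
case: s tb => i [|j q] [t b] feas //= _ ok.
have [ps lc eB okq] := (feasible_subpathE _).1 feas.
have [arcs_q fi /= custq] := (partial_subpathE _).1 ps.
have [_ open0 closeT] := facilityP fi.
have nstq : all (fun k => ~~ is_station k) (belast j q).
  by apply: sub_all custq => k /customerN[].
have bB : 0 <= b <= Bat by case: ok.
have t0 : 0 <= t by case: ok => _ /andP[+ _]; rewrite open0.
rewrite /= in okq.
have key tau : 0 <= tau ->
  run node_ok det_next i (j :: q) (t + tau, g_C I b tau) (t', b') <->
  [/\ t + tau <= sub_start_max (i, j :: q), battery_use (i, j :: q) <= g_C I b tau,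
    t' = Num.max (t + tau + travel_time (i, j :: q)) (sub_end_min (i, j :: q)) &
    b' = g_C I b tau - battery_use (i, j :: q)].
  move=> tau0; have /andP[gb0 gbB] := g_C_range bB tau0.
  have open_le : tw_open i <= t + tau by rewrite open0 addr_ge0.
  have [D1 D2] := run_deterministicP (t + tau) (g_C I b tau) t' b' arcs_q; split.
    move=> /D1[[_ eb _] [okt tE bE]]; split=> //; first exact: tw_ok_latest okt.
    by rewrite tE; exact: end_time_fromE.
  move=> [tS eb tE bE]; apply: D2; split; split=> //.
    exact: (@latest_tw_ok _ _ _ _ i (j :: q) okq tS).
  by rewrite tE; apply/esym; exact: end_time_fromE.
split.
  move=> [_ [tb1 [tau [tau0 tauN tE bE]] r1]]; exists tau.
  have : run node_ok det_next i (j :: q) (t + tau, g_C I b tau) (t', b').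
    split; last by exists tb1 => //; exact/node_run_det.
    split=> /=; first exact: g_C_range.
    rewrite open0 closeT addr_ge0//=.
    have [_ /andP[_]] := run_head r1; rewrite tE ge_max => /andP[+ _] => le1.
    apply: le_trans (close_le_horizon j); apply: le_trans le1.
    by rewrite lerDl ltW// time_gt0//; case/andP: arcs_q.
  by move=> /key-/(_ tau0)[]; split.
move=> [tau [tau0 tauN tS eb [tE bE]]]; split=> //.
have /= [_ [tb1 [tE1 bE1] r1]] := (key tau tau0).2 (And4 tS eb tE bE).
by exists tb1; [exists tau|exact/node_run_det].
Qed.

(** ** Sequences of subpaths *)

(** A run through a sequence of subpaths, from the time and energy level on arrival
    at the first node to those on arrival at the last one. *)
Fixpoint lrun t b ss t' b' : Prop :=
  if ss is s :: ss' then exists t1 b1, lstep s t b t1 b1 /\ lrun t1 b1 ss' t' b'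
  else t' = t /\ b' = b.

Lemma lrun_rcons t b ss s t' b' : lrun t b (rcons ss s) t' b' <->
  exists t1 b1, lrun t b ss t1 b1 /\ lstep s t1 b1 t' b'.
Proof.
elim: ss t b => [|s1 ss IHs] t b /=.
  split; first by move=> [t1 [b1 [st [-> ->]]]]; exists t, b.
  by move=> [t1 [b1 [[-> ->] st]]]; exists t', b'.
split.
  move=> [t1 [b1 [st /IHs[t2 [b2 [r2 st2]]]]]]; exists t2, b2; split=> //.
  by exists t1, b1.
move=> [t2 [b2 [[t1 [b1 [st1 r1]]] st2]]]; exists t1, b1; split=> //.
by apply/IHs; exists t2, b2.
Qed.

(** [chain first i ss]: the feasible complete subpaths in [ss] can be
    concatenated starting from [i]; all of them start at stations, except
    possibly the first one if [first] holds. *)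
Fixpoint chain (first : bool) i ss : Prop :=
  if ss is s :: ss' then
    [/\ s.1 = i, first || is_station i, feasible_subpath s, complete_subpath s &
        chain false (end_node s) ss']
  else True.

(** The nodes of a sequence of subpaths, without the initial one. *)
Definition flat ss : seq I := flatten [seq s.2 | s <- ss].

(** The labels built by the second phase. *)
Definition wf_label l : Prop := is_depot l.1 /\ chain true l.1 l.2.

Lemma chain_rcons c i ss s : chain c i (rcons ss s) <->
  [/\ chain c i ss, s.1 = last i (flat ss), is_station s.1 \/ (c /\ ss = [::]),
      feasible_subpath s & complete_subpath s].
Proof.
elim: ss c i => [|s1 ss IHs] c i /=.
  split.
    move=> [<- ci fs cs _]; split=> //.
    by case: c ci => /= ci; [right|left].
  move=> [_ -> st fs cs]; split=> //.
  by case: st => [->|[-> _]]; rewrite ?orbT.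
have lastE : last i (flat (s1 :: ss)) = last (last i s1.2) (flat ss).
  by rewrite /flat /= last_cat.
rewrite lastE; split.
  move=> [<- ci fs1 cs1 /IHs[chs ss1 st fs cs]]; split=> //.
  by left; case: st => // -[].
move=> [[<- ci fs1 cs1 chs] ss1 st fs cs]; split=> //; apply/IHs; split=> //.
by left; case: st => // -[].
Qed.

Lemma tw_ok_horizon t i q : tw_ok t i q -> end_time_from t i q <= horizon I.
Proof.
move=> okq; apply: le_trans (close_le_horizon (last i q)).
case/lastP: q okq => [|q j]; first exact: tw_ok_close.
by rewrite tw_ok_rcons last_rcons => /andP[].
Qed.

Lemma lstep_le s t b t' b' : feasible_subpath s -> lstep s t b t' b' ->
  t + travel_time s <= t' <= horizon I.
Proof.
case: s => i q /feasible_subpathE[[arcs_s fi _] _ _ okq] [tau [tau0 _ tS _ [-> _]]].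
apply/andP; split; first by rewrite le_max lerD2r lerDl tau0.
rewrite ge_max (tw_ok_horizon okq) andbT.
exact: le_trans (end_time_from_ge _ _ _) (tw_ok_horizon (latest_tw_ok okq tS)).
Qed.

Lemma battery_use_ge0 s : feasible_subpath s -> 0 <= battery_use s <= Bat.
Proof.
case: s => i q /feasible_subpathE[[arcs_s _ _] _ eB _]; rewrite eB andbT.
by apply: arc_sum_ge0 => //; exact: energy_gt0.
Qed.

Lemma travel_time_gt0 s : feasible_subpath s -> complete_subpath s ->
  0 < travel_time s.
Proof.
case: s => i q /feasible_subpathE[[arcs_s _ _] _ _ _] /andP[/= q0 _].
by apply: arc_sum_gt0 => //; [exact: time_gt0|case: q q0 {arcs_s}].
Qed.

Lemma lstep_battery s t b t' b' : feasible_subpath s -> 0 <= b <= Bat ->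
  lstep s t b t' b' -> 0 <= b' <= Bat.
Proof.
move=> fs bB [tau [tau0 _ _ eb [_ ->]]]; have /andP[e0 eB] := battery_use_ge0 fs.
have /andP[_ gB] := g_C_range bB tau0.
by rewrite subr_ge0 eb lerBlDr (le_trans gB)// lerDl.
Qed.

Lemma lrun_battery c i ss t b t' b' : chain c i ss -> 0 <= b <= Bat ->
  lrun t b ss t' b' -> 0 <= b' <= Bat.
Proof.
elim: ss c i t b => [|s ss IHs] c i t b /=; first by move=> _ + [_ ->].
move=> [_ _ fs _ chs] bB [t1 [b1 [st r]]].
by apply: IHs chs _ r; exact: lstep_battery st.
Qed.

Lemma lrun_le c i ss t b t' b' : chain c i ss -> lrun t b ss t' b' ->
  t <= t' /\ (ss <> [::] -> t < t' <= horizon I).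
Proof.
elim: ss c i t b => [|s ss IHs] c i t b /=; first by move=> _ [-> _].
move=> [_ _ fs cs chs] [t1 [b1 [st r]]].
have /andP[tt1 t1T] := lstep_le fs st; have tr := travel_time_gt0 fs cs.
have t_lt : t < t1 by apply: lt_le_trans tt1; rewrite ltrDl.
have [t1t' lt1] := IHs _ _ _ _ chs r.
have lt_t' := lt_le_trans t_lt t1t'; split; first exact: ltW.
move=> _; rewrite lt_t' /=; case: ss {IHs chs} r lt1 => [|s' ss] r lt1.
  by case: r => ->.
by have /andP[] : t1 < t' <= horizon I by exact: lt1.
Qed.

Lemma chain_runP c i ss tb t' b' : chain c i ss -> is_depot i || is_station i ->
  node_ok i tb ->
  run node_ok node_next i (flat ss) tb (t', b') <-> lrun tb.1 tb.2 ss t' b'.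
Proof.
elim: ss c i tb => [|s ss IHs] c i [t b] /=.
  by move=> _ _ ok; split; [move=> [_ [-> ->]]|move=> [-> ->]].
move=> [<- ci fs cs chs] fi ok.
have fe : is_depot (end_node s) || is_station (end_node s) by case/andP: cs.
have -> : flat (s :: ss) = s.2 ++ flat ss by [].
split.
  move=> /run_cat[[t1 b1] r1 r2]; have ok1 := run_last r1.
  exists t1, b1; split; first exact/(subpath_runP _ _ fs cs ok).
  by apply/(IHs _ _ (t1, b1) chs fe ok1).
move=> [t1 [b1 [/(subpath_runP _ _ fs cs ok) r1 r2]]].
apply/run_cat; exists (t1, b1) => //; have ok1 := run_last r1.
by apply/(IHs _ _ (t1, b1) chs fe ok1).
Qed.

Lemma chain_path c i ss : chain c i ss ->
  path (@is_arc R I) i (flat ss) /\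
  all (fun k => is_customer k || is_station k) (behead (belast i (flat ss))).
Proof.
elim: ss c i => [|s ss IHs] c i //= [<- ci fs cs chs].
have [/partial_subpathE[arcs_s _ inner] _ _ _] := (feasible_subpathE _).1 fs.
have [arcs_ss inner_ss] := IHs _ _ chs.
have -> : flat (s :: ss) = s.2 ++ flat ss by [].
split; first by rewrite cat_path; apply/andP.
have {}inner : all (fun k => is_customer k || is_station k) (behead (belast s.1 s.2)).
  by apply: sub_all inner => k ->.
rewrite belast_cat; case: s cs {fs arcs_s arcs_ss ci} inner chs inner_ss.
move=> i' [//|j q] /= _ inner chs inner_ss.
rewrite all_cat inner /=; case: ss {IHs} chs inner_ss => [//|s' ss] [_ st _ _ _].
have -> : flat (s' :: ss) = s'.2 ++ flat ss by [].
case: (_ ++ _) => //= k r ->; rewrite andbT; apply/orP; right.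
by move: st; rewrite /end_node.
Qed.

Lemma wf_partial_path l : wf_label l -> partial_path (concat l).
Proof.
move=> [dl chl]; have [arcs_l inner] := chain_path chl.
split=> //; exact/(interiorP (fun k => is_customer k || is_station k) (concat l)).
Qed.

Lemma feasible_plabelE l : wf_label l -> feasible_plabel l <->
  load (concat l) <= capacity I /\ exists t b, lrun 0 (battery I) l.2 t b.
Proof.
move=> wfl; have [dl chl] := wfl.
have fi : is_depot l.1 || is_station l.1 by rewrite dl.
have ok : node_ok l.1 (0, battery I).
  have [_ open0 closeT] := facilityP fi; split=> /=.
    by rewrite battery_ge0 lexx.
  by rewrite open0 closeT lexx (horizon_ge0 l.1).
have runE t b := @chain_runP _ _ _ _ t b chl fi ok.
split.
  move=> /feasible_partial_pathE[_ lc [[t b] /runE r]]; split=> //.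
  by exists t, b.
move=> [lc [t [b /runE r]]]; apply/feasible_partial_pathE; split=> //.
  exact: wf_partial_path.
by exists (t, b).
Qed.

End Labels.

Section Resources.
Variables (R : realType) (I : instance R).
Implicit Types (i j : I) (q : seq I) (s : nodeseq I) (ss : seq (nodeseq I)).
Implicit Types (l : plabel I) (t b u : R).
Let g := recharge I.
Let h := recharge_inv I.
Let Bat := battery I.

(** ** Schedules *)

(* The end time of [s] when it starts at time [u]. *)
Let arrival s u := Num.max (u + travel_time s) (sub_end_min s).

(* In a schedule, the state at a subpath is the time and the energy level at its
   start. *)
Let sp_ok s (uc : R * R) : Prop :=
  [/\ uc.1 <= sub_start_max s, 0 <= uc.1, 0 <= arrival s uc.1, 0 <= uc.2 &
      battery_use s <= uc.2].

Let sp_next s s' (uc uc' : R * R) : Prop :=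
  exists2 tau, 0 <= tau & uc'.1 = arrival s uc.1 + tau /\
                          uc'.2 = g_C I (uc.2 - battery_use s) tau.

Let sp_run_lrun s ss uc t' b' :
  chain false (end_node s) ss -> sp_ok s uc ->
  (exists2 uc', run sp_ok sp_next s ss uc uc' &
     t' = arrival (last s ss) uc'.1 /\ b' = uc'.2 - battery_use (last s ss)) <->
  lrun (arrival s uc.1) (uc.2 - battery_use s) ss t' b'.
Proof.
elim: ss s uc => [|s' ss IHs] s [u c] /= chs ok.
  by split; [move=> [uc' [_ ->]]|move=> [-> ->]; exists (u, c)].
have [s'1 st fs cs chs'] := chs.
have [_ u0 a0 c0 eb] := ok; split.
  move=> [uc' [_ [[u1 c1] [tau tau0 /= [uE cE]] r]] fin].
  have ok1 := run_head r.
  exists (arrival s' u1), (c1 - battery_use s'); split.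
    exists tau; rewrite /= in ok1; have [uS _ _ _ be] := ok1.
    by rewrite -uE -cE; split=> //; rewrite s'1 st.
  by apply/(IHs _ (u1, c1) chs' ok1); exists uc'.
move=> [t1 [b1 [[tau [tau0 _ tS be [tE bE]]] r]]].
have be0 : 0 <= battery_use s' by case/andP: (battery_use_ge0 fs).
have ok1 : sp_ok s' (arrival s u + tau, g_C I (c - battery_use s) tau).
  split=> //=; first by rewrite addr_ge0.
    by rewrite /arrival -/(arrival s u) le_max !addr_ge0// ltW// travel_time_gt0.
  exact: le_trans be.
have [uc' r' fin] := (IHs s' _ chs' ok1).2 (eq_ind_r (fun x => lrun x _ _ _ _)
  (eq_ind_r (fun x => lrun _ x _ _ _) r (esym bE)) (esym tE)).
exists uc' => //; split=> //.
by eexists; [exists tau|exact: r'].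
Qed.

Lemma scheduleP l t' b' : wf_label l -> l.2 <> [::] ->
  (exists Ts Te Bs Be tau, [/\ schedule l Ts Te Bs Be tau,
     t' = Te (size l.2).-1 & b' = Be (size l.2).-1]) <->
  lrun 0 (battery I) l.2 t' b'.
Proof.
case: l => n [//|s ss] [/= dn [sn _ fs cs chs]] _.
have [_ nst] := depotN dn.
have B0 := battery_ge0 I.
have T0 := horizon_ge0 n.
have /andP[e0 eB] := battery_use_ge0 fs.
have S0 : 0 <= sub_start_max s.
  have /andP[+ _] := feasible_start_max fs.
  have fi : is_depot s.1 || is_station s.1 by rewrite sn dn.
  by have [_ -> _] := facilityP fi.
have tr0 : 0 <= travel_time s by rewrite ltW// travel_time_gt0.
have ok0 : sp_ok s (0, battery I).
  by split=> //=; rewrite /arrival le_max add0r tr0.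
have first_step t1 b1 : lstep s 0 (battery I) t1 b1 <->
    t1 = arrival s 0 /\ b1 = battery I - battery_use s.
  rewrite /lstep sn; split.
    by move=> [tau [_ /(_ nst)-> _ _ [-> ->]]]; rewrite g_C0 ?B0//= addr0.
  by move=> [-> ->]; exists 0; rewrite g_C0 ?B0//= addr0.
have -> : (exists t1 b1, lstep s 0 (battery I) t1 b1 /\ lrun t1 b1 ss t' b') <->
    lrun (arrival s 0) (battery I - battery_use s) ss t' b'.
  split; first by move=> [t1 [b1 [/first_step[-> ->]]]].
  move=> r; exists (arrival s 0), (battery I - battery_use s).
  by split=> //; apply/first_step.
have [RL LR] := @sp_run_lrun s ss (0, battery I) t' b' chs ok0.
have atE k : (k <= size ss)%N -> subpath_at (n, s :: ss) k = nth s (s :: ss) k.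
  by move=> kss; rewrite /subpath_at /=; apply: set_nth_default.
have lastE : nth s (s :: ss) (size ss) = last s ss by rewrite nth_last.
split.
  move=> [Ts [Te [Bs [Be [tau [[[Ts0 Bs0] TeT sub step [ge0 tau0]] /= t'E b'E]]]]]].
  have {}sub k : (k <= size ss)%N -> [/\ Ts k <= sub_start_max (nth s (s :: ss) k),
      Te k = arrival (nth s (s :: ss) k) (Ts k) &
      Be k = Bs k - battery_use (nth s (s :: ss) k)].
    by move=> kss; rewrite -atE//; exact: sub.
  apply: RL; exists (Ts (size ss), Bs (size ss)); last first.
    by have [_ aE beE] := sub (size ss) (leqnn _); rewrite -lastE /= -aE -beE.
  apply/runP; exists (fun k => (Ts k, Bs k)); split=> //=; first by rewrite Ts0 Bs0.
    move=> k kss; have [tE bE] := step k kss; exists (tau k); first exact: tau0.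
    by have [_ aE beE] := sub k (ltnW kss); rewrite /= -aE -beE.
  move=> k kss; have [uS aE beE] := sub k kss; have [u0 a0 c0 be0] := ge0 k kss.
  by split; rewrite -?aE//= -subr_ge0 -beE.
move=> r; have t'T : t' <= horizon I.
  have : lrun 0 (battery I) (s :: ss) t' b'.
    by exists (arrival s 0), (battery I - battery_use s); split=> //; exact/first_step.
  move=> r'; have chl : chain true n (s :: ss) by [].
  by have [_ /(_ _)/andP[]] := lrun_le chl r'.
have [uc' /runP[f [f0 fn next ok]] [t'E b'E]] := LR r.
pose at_ k := nth s (s :: ss) k.
exists (fun k => (f k).1), (fun k => arrival (at_ k) (f k).1), (fun k => (f k).2),
  (fun k => (f k).2 - battery_use (at_ k)),
  (fun k => (f k.+1).1 - arrival (at_ k) (f k).1).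
rewrite /= /at_ lastE fn; split=> //; split=> /=.
- by rewrite f0.
- by rewrite lastE fn -t'E.
- by move=> k kss; rewrite atE//; have [] := ok k kss.
- move=> k kss; have [tau tau0 [tE cE]] := next k kss.
  have tauE : (f k.+1).1 - arrival (at_ k) (f k).1 = tau by rewrite tE addrC addKr.
  by rewrite tauE.
- split.
    by move=> k kss; have [] := ok k kss; split=> //; rewrite subr_ge0.
  by move=> k kss; have [tau tau0 [-> _]] := next k kss; rewrite addrC addKr.
Qed.

(** ** Optimal resources of a label *)

(** [e] is the earliest end time of [l] and [bm] the largest energy level at that
    time; moreover a run that ends later has at most the energy obtained
    from [bm] by charging until then. *)
Definition frontier l e bm : Prop := lrun 0 (battery I) l.2 e bm /\
  forall t b, lrun 0 (battery I) l.2 t b -> e <= t /\ h b <= h bm + (t - e).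

Lemma label_battery l t b : wf_label l -> lrun 0 (battery I) l.2 t b -> 0 <= b <= Bat.
Proof.
by move=> [_ chl]; apply: lrun_battery chl _; rewrite battery_ge0 lexx.
Qed.

Lemma frontier_resources l e bm : wf_label l -> frontier l e bm ->
  path_end_min l = e /\ path_battery_max l = bm.
Proof.
case: l => n [|s ss] wfl [r opt]; first by move: r => /= -[-> ->].
have [SL LS] : (forall t b, (exists Ts Te Bs Be tau,
      [/\ schedule (n, s :: ss) Ts Te Bs Be tau, t = Te (size ss) &
          b = Be (size ss)]) ->
      lrun 0 (battery I) (s :: ss) t b) /\
    (forall t b, lrun 0 (battery I) (s :: ss) t b -> exists Ts Te Bs Be tau,
      [/\ schedule (n, s :: ss) Ts Te Bs Be tau, t = Te (size ss) &
          b = Be (size ss)]).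
  by split=> t b; have [] := @scheduleP (n, s :: ss) t b wfl.
have eE : path_end_min (n, s :: ss) = e.
  rewrite /path_end_min /=; set A := (X in inf X).
  have Ae : A e.
    by have [Ts [Te [Bs [Be [tau [? ? _]]]]]] := LS _ _ r; exists Ts, Te, Bs, Be, tau.
  have lbA : lbound A e.
    move=> _ [Ts [Te [Bs [Be [tau [sch ->]]]]]].
    have : lrun 0 (battery I) (s :: ss) (Te (size ss)) (Be (size ss)).
      by apply: SL; exists Ts, Te, Bs, Be, tau.
    by move=> /opt[].
  apply/le_anti; rewrite (lb_le_inf _ lbA) ?andbT; last by exists e.
  by apply: (ge_inf _ Ae); exists e.
split=> //; rewrite /path_battery_max /= eE; set A := (X in sup X).
have Abm : A bm.
  by have [Ts [Te [Bs [Be [tau [? ? ?]]]]]] := LS _ _ r; exists Ts, Te, Bs, Be, tau.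
have ubA : ubound A bm.
  move=> _ [Ts [Te [Bs [Be [tau [sch TeE ->]]]]]].
  have rb : lrun 0 (battery I) (s :: ss) e (Be (size ss)).
    by apply: SL; exists Ts, Te, Bs, Be, tau.
  have [_] := opt _ _ rb; rewrite subrr addr0 => hle.
  have bmB := label_battery wfl r; have bB := label_battery wfl rb.
  rewrite -(recharge_invK bB) -[leRHS](recharge_invK bmB).
  by apply: recharge_nondecreasing => //; exact: recharge_inv_ge0.
apply/le_anti; rewrite (ge_sup _ ubA) /=; last by exists bm.
by apply: (ub_le_sup _ Abm); exists bm.
Qed.

(** A step that charges at a station, in terms of the departure time. *)
Let lstep_departure s t b t' b' : is_station s.1 ->
  lstep s t b t' b' <-> exists u, [/\ t <= u, u <= sub_start_max s,
    battery_use s <= g (h b + (u - t)) &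
    t' = arrival s u /\ b' = g (h b + (u - t)) - battery_use s].
Proof.
move=> st; split.
  move=> [tau [tau0 _ tS eb fin]]; exists (t + tau).
  by rewrite lerDl [t + tau - t]addrAC subrr add0r.
move=> [u [tu uS eb fin]]; exists (u - t).
have uE : t + (u - t) = u by ring.
by rewrite subr_ge0 uE; split=> //; rewrite st.
Qed.

(** The best run of an extension continues the best run of [l] and charges at the
    station as long as the subpath requires, and longer while this does not delay
    its end time.  A run that charges longer gains no more energy in the
    additional time than charging at the end would give, because its energy level is higher at
    the station than at the end of the subpath. *)
Lemma frontier_step l s e0 b0 t1 b1 t2 b2 : wf_label l -> is_station s.1 ->
  feasible_subpath s -> frontier l e0 b0 ->
  lrun 0 (battery I) l.2 t1 b1 -> lstep s t1 b1 t2 b2 ->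
  exists e bm, lstep s e0 b0 e bm /\
    forall t b t' b', lrun 0 (battery I) l.2 t b -> lstep s t b t' b' ->
      e <= t' /\ h b' <= h bm + (t' - e).
Proof.
move=> wfl st fs [r0 opt] r1 st1.
have b0B := label_battery wfl r0.
have h0 : 0 <= h b0 by exact: recharge_inv_ge0.
have eB := battery_use_ge0 fs; have /andP[eb0 _] := eB.
(* The earliest departure with enough energy for s. *)
pose umin := Num.max e0 (e0 + h (battery_use s) - h b0).
have minP t b u : lrun 0 (battery I) l.2 t b -> t <= u ->
    battery_use s <= g (h b + (u - t)) ->
    umin <= u /\ g (h b + (u - t)) <= g (h b0 + (u - e0)).
  move=> r tu eb; have [et hb] := opt _ _ r.
  have hb_ge0 : 0 <= h b by apply: recharge_inv_ge0; exact: label_battery r.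
  have gle : g (h b + (u - t)) <= g (h b0 + (u - e0)).
    by apply: recharge_nondecreasing; lra.
  split=> //; have := le_trans eb gle.
  rewrite recharge_inv_gal//; last by lra.
  rewrite -/h /umin ge_max => hle; apply/andP; split; lra.
have min_le u : umin <= u -> [/\ e0 <= u, battery_use s <= g (h b0 + (u - e0)) &
    0 <= h b0 + (u - e0)].
  rewrite /umin ge_max => /andP[eu hu].
  by split; [|rewrite recharge_inv_gal//; rewrite -/h|]; lra.
have minS : umin <= sub_start_max s.
  have [u [tu uS eb _]] := (lstep_departure _ _ _ _ st).1 st1.
  by apply: le_trans uS; have [] := minP _ _ _ r1 tu eb.
(* The departure time of the best run. *)
pose v := Num.max umin (Num.min (sub_start_max s) (sub_end_min s - travel_time s)).
have minv : umin <= v by rewrite /v le_max lexx.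
have [ev ebv y0] := min_le v minv.
have vS : v <= sub_start_max s by rewrite /v ge_max minS ge_min lexx.
pose bm := g (h b0 + (v - e0)) - battery_use s.
have bmB : 0 <= bm <= Bat.
  have /andP[_ gB] := recharge_range I y0.
  by rewrite subr_ge0 ebv lerBlDr (le_trans gB)// lerDl.
have arrival_v u : umin <= u -> arrival s v <= arrival s u.
  move=> minu; rewrite /arrival /v.
  case: (leP umin) => c; last by rewrite ge_max !le_max lerD2r minu lexx orbT.
  rewrite ge_max !le_max lexx orbT andbT; apply/orP; right.
  by rewrite -lerBrDr ge_min lexx orbT.
exists (arrival s v), bm; split.
  by apply/lstep_departure => //; exists v.
move=> t b t' b' r /(lstep_departure _ _ _ _ st)[u [tu uS eb [-> ->]]].
have [minu gle] := minP _ _ _ r tu eb; have av := arrival_v u minu.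
split=> //; have [eu ebu x0] := min_le u minu.
have /andP[_ guB] := recharge_range I x0.
have hle : h (g (h b + (u - t)) - battery_use s)
    <= h (g (h b0 + (u - e0)) - battery_use s).
  apply: recharge_inv_mono; rewrite ?subr_ge0 ?lerD2r//.
  by rewrite lerBlDr (le_trans guB)// lerDl.
apply: le_trans hle _.
have [uv|vu] := leP u v.
  apply: (@le_trans _ _ (h bm)); last by rewrite lerDl subr_ge0.
  apply: recharge_inv_mono; rewrite ?subr_ge0//; last by case/andP: bmB.
  by rewrite lerD2r; apply: recharge_nondecreasing => //; rewrite lerD2l lerD2r.
have late : sub_end_min s - travel_time s <= v.
  have : Num.min (sub_start_max s) (sub_end_min s - travel_time s) <= v.
    by rewrite /v le_max lexx orbT.
  rewrite ge_min => /orP[Sv|//].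
  by move: (le_lt_trans (le_trans uS Sv) vu); rewrite ltxx.
have arrivalE w : v <= w -> arrival s w = w + travel_time s.
  by move=> vw; apply/max_idPl; rewrite -lerBlDr (le_trans late).
rewrite (arrivalE u (ltW vu)) (arrivalE v (lexx v)).
have -> : u + travel_time s - (v + travel_time s) = u - v by ring.
have gv : g (h bm) = bm by exact: recharge_invK.
have hbm0 : 0 <= h bm by exact: recharge_inv_ge0.
have hbmy : h bm <= h b0 + (v - e0).
  apply: recharge_inv_le => //; first by case/andP: bmB.
  by rewrite /bm lerBlDr lerDl.
have uv0 : 0 <= u - v by rewrite subr_ge0 ltW.
have := recharge_increment I hbm0 hbmy uv0.
have -> : h b0 + (v - e0) + (u - v) = h b0 + (u - e0) by ring.
rewrite -/g gv => inc; apply: recharge_inv_le; first by rewrite subr_ge0.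
  exact: addr_ge0.
by move: inc; rewrite /bm /g; lra.
Qed.

Lemma frontier_exists l t b : wf_label l -> lrun 0 (battery I) l.2 t b ->
  exists e bm, frontier l e bm.
Proof.
case: l => n ss; elim/last_ind: ss t b => [|ss s IHs] t b wfl r.
  by exists 0, (battery I); split=> // t' b' [-> ->]; rewrite subrr addr0.
have [dn chl] := wfl; have [chss sE st fs cs] := (chain_rcons _ _ _ _).1 chl.
have [t1 [b1 [r1 st1]]] := (lrun_rcons _ _ _ _ _ _).1 r.
have wfss : wf_label (n, ss) by [].
have {st}[st|[_ ss0]] := st.
  have [e0 [b0 fr]] := IHs _ _ wfss r1.
  have [e [bm [st2 opt]]] := frontier_step wfss st fs fr r1 st1.
  exists e, bm; split; first by apply/lrun_rcons; exists e0, b0; split=> //; case: fr.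
  by move=> t' b' /lrun_rcons[t3 [b3 [r3 st3]]]; exact: opt r3 st3.
(* The first subpath starts at a depot, at time 0 and with a full battery. *)
have nst : ~~ is_station s.1.
  by rewrite sE ss0; have [] := depotN dn.
exists t, b; split=> // t' b'; move: r; rewrite ss0 /=.
move=> [t2 [b2 [[tau [_ /(_ nst)-> _ _ [-> ->]]] [-> ->]]]].
move=> [t3 [b3 [[tau3 [_ /(_ nst)-> _ _ [-> ->]]] [-> ->]]]].
by split=> //; rewrite subrr addr0.
Qed.

Lemma feasible_frontier l : wf_label l -> feasible_plabel l ->
  exists e bm, frontier l e bm.
Proof. by move=> wfl /(feasible_plabelE wfl)[_ [t [b]]]; exact: frontier_exists. Qed.

(** ** Domination between labels *)

(** In terms of the optimal resources, a label dominates another one in time and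
    energy when it ends no later and can reach any given energy level at least
    as early by charging at the end node. *)
Lemma frontier_dominates l1 l2 e1 b1 e2 b2 :
  wf_label l1 -> wf_label l2 -> frontier l1 e1 b1 -> frontier l2 e2 b2 ->
  (path_end_min l1 + g_T I (path_battery_max l1)
     (Num.max (path_battery_max l1) (path_battery_max l2)) <= path_end_min l2) =
  (e1 <= e2) && (h b2 - h b1 <= e2 - e1).
Proof.
move=> wf1 wf2 fr1 fr2.
have [-> ->] := frontier_resources wf1 fr1; have [-> ->] := frontier_resources wf2 fr2.
have [b1_ge0 b1B] := andP (label_battery wf1 fr1.1).
have [b2_ge0 b2B] := andP (label_battery wf2 fr2.1).
rewrite /g_T -/h; have [b21|b12] := leP b2 b1.
  have hle : h b2 <= h b1 by exact: recharge_inv_mono.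
  rewrite subrr addr0; have [e12|//] := leP e1 e2.
  by apply/esym; rewrite (@le_trans _ _ 0)// ?subr_le0// subr_ge0.
have hle : h b1 <= h b2 by apply: recharge_inv_mono => //; exact: ltW.
rewrite addrC -lerBrDr; have [//|e21] := leP e1 e2.
by apply/negbTE; rewrite -ltNge (@lt_le_trans _ _ 0)// ?subr_ge0// subr_lt0.
Qed.

Lemma plabel_dominates_refl y l : wf_label l -> feasible_plabel l ->
  plabel_dominates y l l.
Proof.
move=> wfl fl; have [e [bm fr]] := feasible_frontier wfl fl.
by split=> //; rewrite (frontier_dominates wfl wfl fr fr) lexx !subrr lexx.
Qed.

Lemma plabel_dominates_trans y l1 l2 l3 : wf_label l1 -> wf_label l2 -> wf_label l3 ->
  plabel_dominates y l1 l2 -> plabel_dominates y l2 l3 -> plabel_dominates y l1 l3.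
Proof.
move=> wf1 wf2 wf3 [[f1 f2] [n12 k12] c12 d12 t12] [[_ f3] [n23 k23] c23 d23 t23].
have [e1 [b1 fr1]] := feasible_frontier wf1 f1.
have [e2 [b2 fr2]] := feasible_frontier wf2 f2.
have [e3 [b3 fr3]] := feasible_frontier wf3 f3.
split=> //.
- by rewrite n12 k12.
- exact: le_trans c23.
- exact: le_trans d23.
move: t12 t23; rewrite (frontier_dominates wf1 wf2 fr1 fr2).
rewrite (frontier_dominates wf2 wf3 fr2 fr3) (frontier_dominates wf1 wf3 fr1 fr3).
by move=> /andP[e12 h12] /andP[e23 h23]; apply/andP; split; lra.
Qed.

(** Every arc takes time, so a single depot is dominated by itself only. *)
Lemma plabel_dominates_root y l1 l2 : wf_label l1 -> wf_label l2 ->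
  plabel_dominates y l1 l2 -> l2.2 = [::] -> l1 = l2.
Proof.
case: l1 l2 => n1 ss1 [n2 ss2] wf1 wf2 [[f1 f2] [/= n12 _] _ _ t12] ss20.
have [e1 [b1 fr1]] := feasible_frontier wf1 f1.
have [e2 [b2 fr2]] := feasible_frontier wf2 f2.
move: t12; rewrite (frontier_dominates wf1 wf2 fr1 fr2) => /andP[e12 _].
have e20 : e2 = 0 by move: fr2.1; rewrite ss20 => -[].
have [ss10|/eqP ss1N0] := eqVneq ss1 [::]; first by rewrite n12 ss10 ss20.
have [_ /(_ ss1N0)/andP[]] := lrun_le wf1.2 fr1.1.
by rewrite ltNge -e20 e12.
Qed.

Lemma concat_rcons l s : end_node (concat l) = s.1 ->
  [/\ concat (l.1, rcons l.2 s) = (l.1, flat l.2 ++ s.2),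
      end_node (concat (l.1, rcons l.2 s)) = end_node s &
      forall f, arc_sum f (concat (l.1, rcons l.2 s))
        = arc_sum f (concat l) + arc_sum f s].
Proof.
case: s => i q; rewrite /end_node /= => lE.
rewrite /concat /= map_rcons flatten_rcons; split=> //.
  by rewrite last_cat lE.
by move=> f; rewrite arc_sum_cat lE.
Qed.

Lemma load_concat_rcons l s : feasible_subpath s ->
  load (concat (l.1, rcons l.2 s)) = load (concat l) + load s.
Proof.
move=> /feasible_subpathE[[_ fi _] _ _ _]; have [d0 _ _] := facilityP fi.
rewrite /concat /= map_rcons flatten_rcons load_cat; congr (_ + _).
by rewrite /load /nodes big_cons d0 add0r.
Qed.

Lemma wf_label_rcons l s : wf_label (l.1, rcons l.2 s) <->
  [/\ wf_label l, extends l s, feasible_subpath s & complete_subpath s].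
Proof.
split.
  move=> [/= dl /chain_rcons[chl sE st fs cs]]; split=> //; split=> //.
  by case: st => [|[]]; [left|right].
move=> [[dl chl] [sE st] fs cs]; split=> //=; apply/chain_rcons; split=> //.
by case: st => [|]; [left|right].
Qed.

Lemma feasible_plabel_prefix l s : wf_label (l.1, rcons l.2 s) ->
  feasible_plabel (l.1, rcons l.2 s) -> feasible_plabel l.
Proof.
move=> wfls; have [wfl _ fs _] := (wf_label_rcons _ _).1 wfls.
move=> /(feasible_plabelE wfls)[]; rewrite load_concat_rcons// => lc.
move=> [t [b /lrun_rcons[t1 [b1 [r _]]]]]; apply/(feasible_plabelE wfl).
split; last by exists t1, b1.
apply: le_trans lc; rewrite lerDl; apply: sumr_ge0 => i _; exact: demand_ge0.
Qed.

(** Started at the same time, a dominating subpath ends no later. *)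
Lemma dominates_arrival y s1 s2 u : subpath_dominates y s1 s2 ->
  u <= sub_start_max s2 -> arrival s1 u <= arrival s2 u.
Proof.
move=> dom uS; have := dominates_travel_time dom.
have [_ _ _ _ [Emin _ _]] := dom.
rewrite /arrival ge_max !le_max Emin orbT andbT lerD2l.
by case=> tt; apply/orP; [left|right]; lra.
Qed.

Lemma plabel_dominates_rcons y l1 l2 s1 s2 :
  plabel_dominates y l1 l2 -> subpath_dominates y s1 s2 ->
  wf_label l1 -> complete_subpath s1 ->
  wf_label (l2.1, rcons l2.2 s2) -> feasible_plabel (l2.1, rcons l2.2 s2) ->
  [/\ extends l1 s1, wf_label (l1.1, rcons l1.2 s1) &
      plabel_dominates y (l1.1, rcons l1.2 s1) (l2.1, rcons l2.2 s2)].
Proof.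
move=> doml doms wf1 cs1 wf2s f2s.
have [wf2 [l2s2 st2] fs2 cs2] := (wf_label_rcons _ _).1 wf2s.
have [[f1 f2] [n12 k12] c12 d12 t12] := doml.
have [[fs1 _] [sn12 se12] sc12 [sd12 sb12] [_ smax12 _]] := doms.
have root := plabel_dominates_root wf1 wf2 doml.
have l1s1 : end_node (concat l1) = s1.1 by rewrite k12 l2s2.
have ext1 : extends l1 s1.
  by split=> //; rewrite sn12; case: st2 => [|l20]; [left|right; rewrite root].
have wf1s : wf_label (l1.1, rcons l1.2 s1) by exact/wf_label_rcons.
split=> //.
have [_ end1 sum1] := concat_rcons l1s1; have [_ end2 sum2] := concat_rcons l2s2.
have [e2 [b2 fr2]] := feasible_frontier wf2s f2s.
have [t0 [b0 [r0 [tau [tau0 tauN tS eb [e2E b2E]]]]]] :=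
  (lrun_rcons _ _ _ _ _ _).1 fr2.1.
have [eb1_ge0 _] := andP (battery_use_ge0 fs1).
(* The departure time of the given run is kept. *)
have [t [b [r b2b te2]]] : exists t b,
    [/\ lrun 0 (battery I) (rcons l1.2 s1) t b, b2 <= b & t <= e2].
  have [st|[nst [l10 l20]]] : is_station s1.1 \/
      ~~ is_station s1.1 /\ (l1.2 = [::] /\ l2.2 = [::]).
    case: st2 => [|l20]; first by rewrite sn12; left.
    right; rewrite -l1s1 root//; case: wf2 => dl2 _.
    by rewrite /concat l20 /end_node /=; have [] := depotN dl2.
  - have [e1 [b1 fr1]] := feasible_frontier wf1 f1.
    have [e0 [bm0 fr0]] := feasible_frontier wf2 f2.
    move: t12; rewrite (frontier_dominates wf1 wf2 fr1 fr0) => /andP[e10 h10].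
    have [e0t0 h0] := fr0.2 _ _ r0.
    have hb0 : 0 <= h b0 by apply: recharge_inv_ge0; exact: label_battery wf2 r0.
    have e1u : e1 <= t0 + tau by lra.
    have gle : g_C I b0 tau <= g (h b1 + (t0 + tau - e1)).
      by apply: recharge_nondecreasing; rewrite -/h; lra.
    exists (arrival s1 (t0 + tau)), (g (h b1 + (t0 + tau - e1)) - battery_use s1).
    split.
    + apply/lrun_rcons; exists e1, b1; split; first by case: fr1.
      apply/lstep_departure => //; exists (t0 + tau); split=> //; lra.
    + by rewrite b2E; lra.
    + by rewrite e2E; exact: dominates_arrival doms tS.
  - move: r0; rewrite l20 /= => -[t00 b00].
    rewrite sn12 in nst; rewrite l10 /=.
    exists (arrival s1 0), (battery I - battery_use s1); split.
    + exists (arrival s1 0), (battery I - battery_use s1); split=> //.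
      exists 0; rewrite g_C0 ?battery_ge0 ?lexx//= addr0; split=> //.
      * by move: tS; rewrite t00 add0r (tauN nst); lra.
      * by have /andP[] := battery_use_ge0 fs1.
    + by rewrite b2E b00 (tauN nst) g_C0 ?battery_ge0 ?lexx//=; lra.
    + rewrite e2E t00 (tauN nst) addr0; apply: (dominates_arrival doms).
      by move: tS; rewrite t00 (tauN nst) addr0.
have lc : load (concat (l1.1, rcons l1.2 s1)) <= capacity I.
  have [+ _] := (feasible_plabelE wf2s).1 f2s.
  by apply: le_trans; rewrite !load_concat_rcons// lerD.
have f1s : feasible_plabel (l1.1, rcons l1.2 s1).
  by apply/(feasible_plabelE wf1s); split=> //; exists t, b.
have [e1 [b1 fr1]] := feasible_frontier wf1s f1s.
have [b2_ge0 _] := andP (label_battery wf2s fr2.1).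
have [_ bB] := andP (label_battery wf1s r).
split=> //.
- by rewrite end1 end2.
- by rewrite sum1 sum2 lerD.
- by rewrite !load_concat_rcons// lerD.
rewrite (frontier_dominates wf1s wf2s fr1 fr2).
have [e1t hb] := fr1.2 _ _ r.
have := recharge_inv_mono b2_ge0 b2b bB; rewrite -/h => hb2.
by apply/andP; split; lra.
Qed.

End Resources.

(** * The pricing problem *)

Section Pricing.
Variables (R : realType) (I : instance R).
Implicit Types (i j : I) (q : seq I) (s : nodeseq I) (ss : seq (nodeseq I)).
Implicit Types (l : plabel I) (p : nodeseq I) (t b u : R) (y : duals I).

(** ** Finitely many labels *)

Lemma arc_time_bound : exists2 e : R, 0 < e & forall i j, is_arc i j -> e <= time i j.
Proof.
pose A := [set a : I * I | is_arc a.1 a.2].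
have [A0|/set0P A0] := eqVneq A set0.
  exists 1 => // i j ij; exfalso.
  by have : A (i, j) by []; rewrite A0.
have [a Aa mina] := @argmin_finite R _ A (fun a => time a.1 a.2) finite_finset A0.
exists (time a.1 a.2); first exact: time_gt0.
by move=> i j ij; exact: (mina (i, j)).
Qed.

Lemma size_bound : exists N : nat, forall i q,
  path (@is_arc R I) i q -> travel_time (i, q) <= horizon I -> (size q <= N)%N.
Proof.
have [e e0 arc_e] := arc_time_bound.
have sum_ge i q : path (@is_arc R I) i q -> (size q)%:R * e <= travel_time (i, q).
  elim: q i => [|j q IHq] i /=; first by rewrite mul0r /travel_time arc_sum0.
  move=> /andP[ij /IHq leq]; rewrite /travel_time arc_sum_cons.
  by rewrite -natr1 mulrDl mul1r addrC lerD// arc_e.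
exists (Num.bound (horizon I / e)) => i q qp qT.
have T0 := horizon_ge0 i.
rewrite -(ler_nat R); apply: le_trans (ltW (archi_boundP _)); last first.
  by rewrite divr_ge0// ltW.
by rewrite ler_pdivlMr//; apply: le_trans qT; exact: sum_ge.
Qed.

(** The labels that occur in the first phase: those that are inserted, and the
    initial ones, which are infeasible if the capacity is negative. *)
Definition subpath_labels : set (nodeseq I) :=
  [set s | subpath_roots s \/ feasible_subpath s].

(** The labels that occur in the second phase. *)
Definition path_labels : set (plabel I) :=
  [set l | wf_label l /\ (l.2 = [::] \/ feasible_plabel l)].

Lemma finite_nodeseqs n : finite_set [set s : nodeseq I | (size s.2 <= n)%N].
Proof.
have fin := finite_setX (@finite_finset I setT)
  (finite_bounded_seqs n (@finite_finset I setT)).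
by apply: sub_finite_set fin => -[i q].
Qed.

Lemma feasible_travel_time s : feasible_subpath s ->
  along_arcs s /\ travel_time s <= horizon I.
Proof.
case: s => i q /feasible_subpathE[[arcs_s _ _] _ _ okq]; split=> //.
apply: le_trans (tw_ok_horizon okq); apply: le_trans (end_time_from_ge _ _ _).
by rewrite lerDr open_ge0.
Qed.

Lemma finite_subpath_labels : finite_set subpath_labels.
Proof.
have [N sizeN] := size_bound.
apply: sub_finite_set (finite_nodeseqs N) => -[i q] [[/= -> _]//|].
by move=> /feasible_travel_time[arcs_s]; exact: sizeN.
Qed.

Lemma lrun_travel_time c i ss t b t' b' : chain c i ss -> lrun t b ss t' b' ->
  t + travel_time (i, flat ss) <= t'.
Proof.
elim: ss c i t b => [|s ss IHs] c i t b /=.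
  by move=> _ [-> _]; rewrite /travel_time arc_sum0 addr0.
move=> [<- _ fs _ chs] [t1 [b1 [st /(IHs _ _ _ _ chs) tt']]].
have /andP[tt1 _] := lstep_le fs st; apply: le_trans tt'.
have -> : travel_time (s.1, flat (s :: ss))
    = travel_time s + travel_time (end_node s, flat ss).
  by case: s {fs chs st tt1} => i' q'; exact: arc_sum_cat.
by rewrite addrA lerD2r.
Qed.

Lemma size_chain c i ss : chain c i ss -> (size ss <= size (flat ss))%N.
Proof.
elim: ss c i => [|s ss IHs] c i //= [_ _ _ /andP[s0 _] chs].
have -> : flat (s :: ss) = s.2 ++ flat ss by [].
by rewrite size_cat; have := IHs _ _ chs; lia.
Qed.

Lemma chain_feasible c i ss s : chain c i ss -> s \in ss -> feasible_subpath s.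
Proof.
elim: ss c i => [|s' ss IHs] c i //= [_ _ fs _ chs].
by rewrite inE => /orP[/eqP->//|]; exact: IHs chs.
Qed.

Lemma finite_path_labels : finite_set path_labels.
Proof.
have [N sizeN] := size_bound.
have fin := finite_setX (@finite_finset I setT)
  (finite_bounded_seqs N finite_subpath_labels).
apply: sub_finite_set fin => -[n ss] [wfl fl]; split=> //=; split.
  case: fl => [/= ->//|/(feasible_plabelE wfl)[_ [t [b r]]]].
  have [_ chl] := wfl; apply: leq_trans (size_chain chl) _; apply: (sizeN n).
    by have [] := chain_path chl.
  have [ss0|/eqP ssN0] := eqVneq ss [::].
    by rewrite ss0 /flat /= /travel_time arc_sum0 (horizon_ge0 n).
  have := lrun_travel_time chl r; rewrite add0r => /le_trans; apply.
  by have [_ /(_ ssN0)/andP[]] := lrun_le chl r.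
by move=> s sss; right; exact: chain_feasible wfl.2 sss.
Qed.

(** ** Decomposition of paths into subpaths *)

Lemma run_feasible_subpath s tb tb' : partial_subpath s -> (0 < size s.2)%N ->
  load s <= capacity I -> run (@node_ok R I) (@node_next R I) s.1 s.2 tb tb' ->
  feasible_subpath s.
Proof.
case: s tb' => i [//|j q] [t' b'] ps _ lc.
have [arcs_q fi /= custq] := (partial_subpathE _).1 ps.
have [_ open0 _] := facilityP fi.
move=> [ok [[t1 b1] [tau [tau0 _ /= tE bE]] r]].
have nstq : all (fun k => ~~ is_station k) (belast j q).
  by apply: sub_all custq => k /customerN[].
have /andP[ij arcs_q'] : is_arc i j && path (@is_arc R I) j q := arcs_q.
move/(node_run_det _ _ nstq)/(run_deterministicP _ _ _ _ arcs_q') : r.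
move=> [[_ eb _] [okq _ _]].
have [bB /andP[t0 tc]] := ok; rewrite open0 in t0.
apply/feasible_subpathE; split=> //.
  rewrite /battery_use arc_sum_cons.
  have /andP[_ gB] := g_C_range bB tau0.
  by apply: le_trans gB; rewrite -lerBrDl -bE.
apply/andP; split; first exact: open_le_close.
apply: tw_ok_le okq; rewrite tE ge_max !le_max lexx orbT andbT open0.
by rewrite lerD2r addr_ge0.
Qed.

(** A run whose end nodes are depots or stations is cut at each visit of a
    station. *)
Lemma decompose_path first i q tb tb' : is_depot i || is_station i ->
  (q != [::] -> first || is_station i) -> path (@is_arc R I) i q ->
  all (fun k => is_customer k || is_station k) (behead (belast i q)) ->
  is_depot (last i q) || is_station (last i q) ->
  run (@node_ok R I) (@node_next R I) i q tb tb' -> load (i, q) <= capacity I ->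
  exists2 ss, chain first i ss & flat ss = q.
Proof.
move: {2}(size q) (leqnn (size q)) => n.
elim: n first i q tb => [|n IHn] first i q tb.
  by case: q => // _ *; exists [::].
have [->|qN0] := eqVneq q [::]; first by exists [::].
move=> szq fi /(_ isT) ci arcs_q inner fl r lc.
have hasq : has (fun k => is_depot k || is_station k) q.
  apply/hasP; exists (last i q) => //.
  by case: q qN0 {szq arcs_q inner fl r lc} => //= j q _; exact: mem_last.
case: (split_find hasq) => j q1 q2 fj custq in szq arcs_q inner fl r lc *.
have {}custq : all (@is_customer R I) q1.
  rewrite -all_predC in custq; apply: sub_all custq => k /=.
  by have [|->|->] := kindP k; rewrite ?orbT.
move: arcs_q; rewrite cat_path last_rcons => /andP[arcs1 arcs2].
have /run_cat[[t1 b1] r1] := r; rewrite last_rcons => r2.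
have ps : partial_subpath (i, rcons q1 j).
  by apply/partial_subpath_rcons; move: arcs1; rewrite rcons_path => /andP[].
have dem_ge0 q' : 0 <= \sum_(k <- q') demand k.
  by apply: sumr_ge0 => k _; exact: demand_ge0.
have lc1 : load (i, rcons q1 j) <= capacity I.
  by apply: le_trans lc; rewrite load_cat lerDl.
have fs : feasible_subpath (i, rcons q1 j).
  by apply: (@run_feasible_subpath (i, rcons q1 j) _ _ ps _ lc1 r1); rewrite size_rcons.
have cs : complete_subpath (i, rcons q1 j).
  by rewrite /complete_subpath /end_node /= size_rcons last_rcons.
have [q20|q2N0] := eqVneq q2 [::].
  exists [:: (i, rcons q1 j)]; first by split.
  by rewrite q20 /flat.
move: inner; rewrite belast_cat belast_rcons last_rcons /= all_cat => /andP[_].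
case: q2 q2N0 => // k q2 _ in szq arcs2 fl r lc r2 * => /andP[csj inner].
have stj : is_station j.
  case/orP: csj => // /customerN[/negbTE dj /negbTE stj].
  by rewrite dj stj in fj.
have [||||ss chs flE] := IHn false j (k :: q2) _ _ fj _ arcs2 inner _ r2.
- move: szq; rewrite size_cat size_rcons addSn ltnS.
  by apply: leq_trans; rewrite leq_addl.
- by move=> _; rewrite stj.
- by move: fl; rewrite last_cat last_rcons.
- apply: le_trans lc; rewrite load_cat load_rcons /load /nodes !big_cons.
  have [dj _ _] := facilityP fj; rewrite dj add0r lerDr.
  by rewrite !addr_ge0// demand_ge0.
exists ((i, rcons q1 j) :: ss); first by split=> //; rewrite /end_node /= last_rcons.
by rewrite /flat /= -/(flat ss) flE.
Qed.

Lemma path_label p : feasible_partial_path p -> complete_path p ->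
  exists2 l, wf_label l & concat l = p.
Proof.
case: p => i q /feasible_partial_pathE[[arcs_q dp inner] lc [tb r]] /andP[_ dl].
have fi : is_depot i || is_station i by move: dp => /= ->.
have [||ss chs flE] := @decompose_path true i q _ _ fi (fun=> isT) arcs_q _ _ r lc.
- exact/(interiorP (fun k => is_customer k || is_station k) (i, q)).
- by move: dl; rewrite /end_node /= => ->.
by exists (i, ss) => //; rewrite /concat /= -/(flat ss) flE.
Qed.

Lemma finite_feasible_paths : finite_set (@feasible_paths R I).
Proof.
apply: sub_finite_set (finite_image (@concat R I) finite_path_labels).
move=> p [fp cp]; have [l wfl lE] := path_label fp cp.
by exists l => //; split=> //; right; rewrite /feasible_plabel lE.
Qed.

End Pricing.

Section TwoPhases.
Variables (R : realType) (I : instance R) (y : duals I).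
Implicit Types (i j : I) (q : seq I) (s : nodeseq I) (ss : seq (nodeseq I)).
Implicit Types (l : plabel I) (p : nodeseq I) (Sstar : set (nodeseq I)).

(** ** First phase *)

Definition subpath_inv : ls_state (nodeseq I) -> Prop :=
  ls_inv (@complete_subpath R I) (@subpath_ext R I) (@feasible_subpath R I)
    (subpath_dominates y) (@subpath_roots R I) (@subpath_labels R I).

Lemma finite_subpath_ext s : finite_set (subpath_ext s).
Proof. by apply: finite_image; exact: finite_finset. Qed.

Lemma subpath_inv_init : subpath_inv (ls_init (@subpath_roots R I)).
Proof.
apply: ls_inv_init; first by move=> s; left.
by move=> s _; exact: subpath_dominates_refl.
Qed.

Lemma subpath_inv_step st st' : subpath_inv st -> subpath_step y st st' ->
  subpath_inv st'.
Proof.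
apply: ls_inv_step.
- by move=> s; left.
- by move=> s e _ _ _ fe; right.
- by move=> s _; exact: finite_subpath_ext.
- by move=> s _; exact: subpath_dominates_refl.
- by move=> s1 s2 s3 _ _ _; exact: subpath_dominates_trans.
Qed.

Lemma subpath_measure_step st st' : subpath_inv st -> subpath_step y st st' ->
  slexprod _ _ lt lt (ls_measure (@subpath_labels R I) st')
    (ls_measure (@subpath_labels R I) st).
Proof. by apply: ls_measure_step; exact: finite_subpath_labels. Qed.

Lemma subpath_progress st : subpath_inv st ->
  ls_done st \/ exists st', subpath_step y st st'.
Proof. by apply: ls_progress; exact: finite_subpath_labels. Qed.

Lemma subpath_cover st s : subpath_inv st -> ls_done st -> feasible_subpath s ->
  exists2 s', ls_gen st s' & subpath_dominates y s' s.
Proof.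
move=> inv_st done_st; case: s => i q.
elim/last_ind: q => [|q j IHq] fs.
  apply: (ls_done_root inv_st done_st) => //; split=> //.
  by have [[_ fi _] _ _ _] := (feasible_subpathE _).1 fs.
have [fq ps _ _ _] := (feasible_subpath_rcons _ _ _).1 fs.
have [_ arc_j _ custq] := (partial_subpath_rcons _ _ _).1 ps.
have [s' gs' dom] := IHq fq.
have dom_j := subpath_dominates_rcons dom fs.
have endE : end_node s' = last i q by case: dom => _ [].
have ncs' : ~~ complete_subpath s'.
  have [q0|qN0] := eqVneq q [::].
    by rewrite (subpath_dominates_root dom q0) q0.
  have /customerN[/negbTE nd /negbTE nst] := all_last i custq qN0.
  by rewrite /complete_subpath endE nd nst andbF.
have [fs'j _] : feasible_subpath (s'.1, rcons s'.2 j) /\ True by case: dom_j => -[].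
have [s'' gs'' dom''] : exists2 s'', ls_gen st s'' &
    subpath_dominates y s'' (s'.1, rcons s'.2 j).
  apply: (ls_done_ext inv_st done_st gs' ncs') => //.
  by exists j => //=; rewrite endE.
by exists s'' => //; exact: subpath_dominates_trans dom'' dom_j.
Qed.

(** What the first phase achieves: a complete subpath is dominated by a returned
    one, unless it is a cycle of nonnegative reduced cost, which its initial node
    alone may dominate. *)
Definition covers_subpaths Sstar : Prop :=
  [/\ finite_set Sstar,
      forall s, Sstar s -> feasible_subpath s /\ complete_subpath s &
      forall s, feasible_subpath s -> complete_subpath s ->
        (exists2 s', Sstar s' & subpath_dominates y s' s) \/
        end_node s = s.1 /\ 0 <= arc_sum (reduced_arc_cost y) s].

Lemma first_phase_covers st : subpath_inv st -> ls_done st ->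
  covers_subpaths (ls_result (@complete_subpath R I) st).
Proof.
move=> inv_st done_st.
have genU := ls_genU inv_st; split.
- by apply: sub_finite_set (@finite_subpath_labels R I) => s [/genU].
- by move=> s [/genU[[s0 _]|//] cs]; move: cs; rewrite /complete_subpath s0.
move=> s fs cs; have [s' gs' dom] := subpath_cover inv_st done_st fs.
have [_ [n12 e12] c12 _ _] := dom.
have [cs'|] := boolP (complete_subpath s'); first by left; exists s'.
rewrite /complete_subpath e12; have /andP[_ ->] := cs.
rewrite andbT -leqNgt leqn0 => /eqP/size0nil s'0; right.
move: e12 c12 n12; case: s' s'0 {gs' dom} => i q /= ->.
by rewrite /end_node arc_sum0 /= => <- c12 ->.
Qed.

(** ** Second phase *)

Definition plabel_inv Sstar : ls_state (plabel I) -> Prop :=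
  ls_inv (@complete_plabel R I) (plabel_ext Sstar) (@feasible_plabel R I)
    (plabel_dominates y) (@plabel_roots R I) (@path_labels R I).

Lemma plabel_roots_labels : @plabel_roots R I `<=` @path_labels R I.
Proof. by move=> [n ss] [/= -> dn]; split=> //; left. Qed.

Lemma plabel_inv_init Sstar : plabel_inv Sstar (ls_init (@plabel_roots R I)).
Proof.
apply: ls_inv_init; first exact: plabel_roots_labels.
by move=> l [wfl _]; exact: plabel_dominates_refl.
Qed.

Lemma plabel_inv_step Sstar st st' : covers_subpaths Sstar ->
  plabel_inv Sstar st -> plabel_step Sstar y st st' -> plabel_inv Sstar st'.
Proof.
move=> [finS fcS _]; apply: ls_inv_step.
- exact: plabel_roots_labels.
- move=> l e [wfl _] _ [s [/fcS[fs cs] ext_s] <-] fe; split; last by right.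
  exact/wf_label_rcons.
- move=> l _; apply: finite_image.
  by apply: sub_finite_set finS => s [].
- by move=> l [wfl _]; exact: plabel_dominates_refl.
- by move=> l1 l2 l3 [wf1 _] [wf2 _] [wf3 _]; exact: plabel_dominates_trans.
Qed.

Lemma plabel_measure_step Sstar st st' : plabel_inv Sstar st ->
  plabel_step Sstar y st st' ->
  slexprod _ _ lt lt (ls_measure (@path_labels R I) st')
    (ls_measure (@path_labels R I) st).
Proof. by apply: ls_measure_step; exact: finite_path_labels. Qed.

Lemma plabel_progress Sstar st : plabel_inv Sstar st ->
  ls_done st \/ exists st', plabel_step Sstar y st st'.
Proof. by apply: ls_progress; exact: finite_path_labels. Qed.

(** A final cycle of nonnegative reduced cost can be dropped: it only uses energy,
    and the time spent charging before it can be spent charging without it. *)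
Lemma plabel_dominates_cycle l s : wf_label (l.1, rcons l.2 s) ->
  feasible_plabel (l.1, rcons l.2 s) -> end_node s = s.1 ->
  0 <= arc_sum (reduced_arc_cost y) s ->
  plabel_dominates y l (l.1, rcons l.2 s).
Proof.
move=> wfls fls cyc rc0.
have [wfl [ls st] fs cs] := (wf_label_rcons _ _).1 wfls.
have fl := feasible_plabel_prefix wfls fls.
have [e1 [b1 fr1]] := feasible_frontier wfl fl.
have [e2 [b2 fr2]] := feasible_frontier wfls fls.
have [_ endE sumE] := concat_rcons ls.
split=> //.
- by rewrite endE ls cyc.
- by rewrite sumE lerDl.
- rewrite load_concat_rcons// lerDl; apply: sumr_ge0 => i _; exact: demand_ge0.
rewrite (frontier_dominates wfl wfls fr1 fr2).
have [t0 [b0 [r0 [tau [tau0 tauN tS eb [e2E b2E]]]]]] :=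
  (lrun_rcons _ _ _ _ _ _).1 fr2.1.
have [et h0] := fr1.2 _ _ r0.
have b0B := label_battery wfl r0.
have /andP[e0 _] := battery_use_ge0 fs.
have tr := travel_time_gt0 fs cs.
have [b2_ge0 b2B] := andP (label_battery wfls fr2.1).
have hle : recharge_inv I b2 <= recharge_inv I b0 + tau.
  apply: recharge_inv_le => //; first by rewrite addr_ge0// recharge_inv_ge0.
  by rewrite b2E lerBlDr lerDl.
have e2_ge : t0 + tau + travel_time s <= e2 by rewrite e2E le_max lexx.
by apply/andP; split; lra.
Qed.

Lemma plabel_cover Sstar st l : covers_subpaths Sstar ->
  plabel_inv Sstar st -> ls_done st -> wf_label l -> feasible_plabel l ->
  exists2 l', ls_gen st l' & plabel_dominates y l' l.
Proof.
move=> [_ fcS covS] inv_st done_st; case: l => n ss.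
elim/last_ind: ss => [|ss s IHss] wfl fl.
  by apply: (ls_done_root inv_st done_st) => //; split=> //; case: wfl.
have [wfp [ps st_s] fs cs] := (wf_label_rcons (n, ss) s).1 wfl.
have fp := @feasible_plabel_prefix _ _ (n, ss) s wfl fl.
have [l' gl' dom] := IHss wfp fp.
have [wfl' _] := ls_genU inv_st gl'.
have [[s' Ss' doms]|[cyc rc0]] := covS s fs cs; last first.
  exists l' => //; apply: (plabel_dominates_trans wfl' wfp wfl dom).
  exact: (@plabel_dominates_cycle (n, ss)).
have [fs' cs'] := fcS _ Ss'.
have [ext' wf' dom'] := plabel_dominates_rcons dom doms wfl' cs' wfl fl.
have ncl' : ~~ complete_plabel l'.
  have [_ [_ endE] _ _ _] := dom.
  rewrite /complete_plabel /complete_path endE ps; case: st_s => [st_s|ss0].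
    by have [_ /negbTE->] := stationN st_s; rewrite andbF.
  by rewrite (plabel_dominates_root wfl' wfp dom ss0) /concat /= (ss0 : ss = [::]).
have fl's : feasible_plabel (l'.1, rcons l'.2 s') by case: dom' => -[].
have [l'' gl'' dom''] : exists2 l'', ls_gen st l'' &
    plabel_dominates y l'' (l'.1, rcons l'.2 s').
  by apply: (ls_done_ext inv_st done_st gl' ncl') => //; exists s'.
have [wfl'' _] := ls_genU inv_st gl''.
by exists l'' => //; exact: plabel_dominates_trans wfl'' wf' wfl dom'' dom'.
Qed.

(** ** Reduced costs *)

(* The dual values collected on entering [j]. *)
Let head_dual j : R :=
  (if is_depot j then mu y j else 0) + (if is_customer j then nu y j else 0).

Lemma arc_sum_reduced i q : arc_sum (reduced_arc_cost y) (i, q) =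
  arc_sum (@cost R I) (i, q)
  - \sum_(k <- belast i q) (if is_depot k then kappa y k else 0)
  - \sum_(k <- q) head_dual k.
Proof.
elim: q i => [|j q IHq] i; first by rewrite !arc_sum0 /= !big_nil !subr0.
rewrite !arc_sum_cons IHq /= !big_cons /reduced_arc_cost /head_dual; ring.
Qed.

Lemma sum_visits (f : I -> R) (r : seq I) :
  \sum_(i | is_customer i) (count_mem i r)%:R * f i =
  \sum_(k <- r) (if is_customer k then f k else 0).
Proof.
elim: r => [|k r IHr]; first by rewrite big_nil big1// => i _; rewrite mul0r.
rewrite big_cons -IHr /=.
under eq_bigr => i _ do rewrite natrD mulrDl.
rewrite big_split /=; congr (_ + _).
case: ifPn => ck.
  rewrite (bigD1 k)//= eqxx mul1r big1 ?addr0// => i /andP[_ /negbTE ik].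
  by rewrite eq_sym ik mul0r.
rewrite big1// => i ci; have [ki|] := eqVneq k i; last by rewrite mul0r.
by move: ck; rewrite ki ci.
Qed.

Lemma reduced_costE p : partial_path p -> complete_path p ->
  reduced_cost y p = arc_sum (reduced_arc_cost y) p.
Proof.
case: p => i q [_ /= di inner] /andP[/= q0 dl].
rewrite arc_sum_reduced /reduced_cost /path_cost sum_visits /nodes /= big_cons.
have [/negbTE -> _] := depotN di; rewrite add0r.
have {}inner := (interiorP (fun k => is_customer k || is_station k) (i, q)).1 inner.
rewrite /end_node /= in dl *; rewrite /= in inner.
have inner_nd k : is_customer k || is_station k -> is_depot k = false.
  by case/orP => [/customerN[/negbTE]|/stationN[_ /negbTE]].
case/lastP: q q0 dl inner => // q j _; rewrite last_rcons belast_rcons /= => dj inner.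
have no_depot (f : I -> R) : \sum_(k <- q) (if is_depot k then f k else 0) = 0.
  by apply: big1_seq => k /andP[_ kq]; rewrite inner_nd//; exact: (allP inner).
rewrite [\sum_(k <- i :: q) _]big_cons di no_depot.
rewrite [\sum_(k <- _) head_dual k]big_split /= -[in X in _ - (X + _)]cats1 big_cat.
rewrite /= big_seq1 no_depot dj; ring.
Qed.

(** The pricing problem is solved exactly: if some feasible path has a negative
    reduced cost, then such a path is returned. *)
Lemma pricing_exact Sstar st p : covers_subpaths Sstar ->
  plabel_inv Sstar st -> ls_done st -> feasible_paths p -> reduced_cost y p < 0 ->
  new_paths y st !=set0.
Proof.
move=> covS inv_st done_st [fp cp] rc0.
have [l wfl lE] := path_label fp cp.
have fl : feasible_plabel l by rewrite /feasible_plabel lE.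
have [l' gl' [[fl' _] [_ endE] rc _ _]] := plabel_cover covS inv_st done_st wfl fl.
have [pp _ _] := (feasible_partial_pathE _).1 fp.
have [pp' _ _] := (feasible_partial_pathE _).1 fl'.
have rc' : arc_sum (reduced_arc_cost y) (concat l') < 0.
  by apply: le_lt_trans rc _; rewrite lE -reduced_costE.
have cl' : complete_path (concat l').
  rewrite /complete_path endE lE; have /andP[_ ->] := cp.
  rewrite andbT lt0n; apply/eqP => /size0nil q0.
  by move: rc'; case: (concat l') q0 => i q /= ->; rewrite arc_sum0 ltxx.
exists (concat l'); split; last by rewrite reduced_costE.
by exists l'.
Qed.

Lemma new_paths_feasible Sstar st p : plabel_inv Sstar st -> new_paths y st p ->
  feasible_paths p /\ reduced_cost y p < 0.
Proof.
move=> inv_st [[l [gl cl] <-] rc]; split=> //; split=> //.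
have [_ [l0|//]] := ls_genU inv_st gl.
by move: cl; rewrite /complete_plabel /complete_path /concat /= l0.
Qed.

End TwoPhases.

(** * The master problem *)

Section Master.
Variables (R : realType) (I : instance R).
Implicit Types (i j : I) (p : nodeseq I) (z : nodeseq I -> R) (y : duals I).
Implicit Types (P : set (nodeseq I)).

Lemma master_extend P P' z : P `<=` P' -> master_feasible P z ->
  master_feasible P' z /\ master_value P' z = master_value P z.
Proof.
move=> PP' [[z0P z_ge0] zstart zend zvis].
have widen (f : nodeseq I -> R) :
    \sum_(p \in P') f p * z p = \sum_(p \in P) f p * z p.
  apply/esym/fsbig_widen => // p [_ nPp] /=; by rewrite z0P// mulr0.
split; last exact: widen.
split.
- by split=> // p nP'p; apply: z0P => Pp; apply: nP'p; exact: PP'.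
- by move=> j dj; rewrite widen; exact: zstart.
- by move=> j dj; rewrite widen; exact: zend.
- by move=> i ci; rewrite widen; exact: zvis.
Qed.

Section FixedPaths.
Variable P : set (nodeseq I).
Hypothesis PF : P `<=` @feasible_paths R I.

Let finP : finite_set P := sub_finite_set PF (finite_feasible_paths I).

(** The master problem in standard form: its rows are the depots as start nodes,
    the depots as end nodes and the customers; its columns are the paths and one
    surplus variable for each depot.  The rows of other nodes are zero. *)
Let row := (I + I + I)%type.
Let column := (nodeseq I + I)%type.

Let columns : seq column :=
  [seq inl p | p <- fset_set P] ++ [seq inr d | d <- enum (@is_depot R I)].

Let coef (c : column) (k : row) : R :=
  match c, k with
  | inl p, inl (inl j) => if is_depot j then starts_at j p else 0
  | inl p, inl (inr j) => if is_depot j then ends_at j p else 0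
  | inl p, inr i => if is_customer i then (visits i p)%:R else 0
  | inr d, inl (inr j) => - (d == j)%:R
  | inr _, _ => 0
  end.

Let column_cost (c : column) : R := if c is inl p then path_cost p else 0.

Let rhs (k : row) : R :=
  match k with
  | inl (inl j) => if is_depot j then (vstart j)%:R else 0
  | inl (inr j) => if is_depot j then (vend j)%:R else 0
  | inr i => if is_customer i then 1 else 0
  end.

Let dual_vector y (k : row) : R :=
  match k with
  | inl (inl j) => kappa y j
  | inl (inr j) => mu y j
  | inr i => nu y i
  end.

Let uniq_columns : uniq columns.
Proof.
rewrite cat_uniq !map_inj_uniq ?fset_uniq ?enum_uniq ?andbT//=.
- by apply/hasPn => _ /mapP[d _ ->]; apply/negP => /mapP[].
- by move=> ? ? [].
- by move=> ? ? [].
Qed.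

Let mem_columns c : (c \in columns) <->
  match c with inl p => P p | inr d => is_depot d end.
Proof.
rewrite mem_cat; case: c => [p|d].
  rewrite (mem_map (fun _ _ => @inl_inj _ _ _ _)) in_fset_set// orbC.
  have -> : (inl p \in [seq inr d | d <- enum (@is_depot R I)]) = false.
    by apply/negP => /mapP[].
  by split=> [/set_mem|/mem_set].
rewrite (mem_map (fun _ _ => @inr_inj _ _ _ _)) mem_enum.
have -> : (inr d \in [seq inl p | p <- fset_set P]) = false.
  by apply/negP => /mapP[].
by [].
Qed.

Let sum_pick (f : I -> R) d : is_depot d ->
  \sum_j f j * (if is_depot j then (d == j)%:R else 0) = f d.
Proof.
move=> dd; rewrite (bigD1 d)//= dd eqxx mulr1 big1 ?addr0// => j /negbTE jd.
by rewrite eq_sym jd if_same mulr0.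
Qed.

Let dotp_path y p : P p -> dotp (dual_vector y) (coef (inl p)) =
  kappa y p.1 + mu y (end_node p) + \sum_(i | is_customer i) (visits i p)%:R * nu y i.
Proof.
move=> /PF[[[_ dp _] _] /andP[_ de]].
rewrite /dotp !big_sumType /= (sum_pick _ dp) (sum_pick _ de); congr (_ + _).
by rewrite [RHS]big_mkcond; apply: eq_bigr => i _; case: ifP; rewrite ?mulr0// mulrC.
Qed.

Let dotp_surplus y d : dotp (dual_vector y) (coef (inr d)) = - mu y d.
Proof.
rewrite /dotp !big_sumType /= big1 ?add0r; last by move=> j _; rewrite mulr0.
rewrite [X in _ + X]big1 ?addr0; last by move=> j _; rewrite mulr0.
rewrite (bigD1 d)//= eqxx mulrN1 big1 ?addr0// => j /negbTE jd.
by rewrite eq_sym jd oppr0 mulr0.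
Qed.

Let dotp_rhs y : dotp (dual_vector y) rhs = dual_value y.
Proof.
rewrite /dotp !big_sumType /= /dual_value.
by congr (_ + _ + _); rewrite [RHS]big_mkcond; apply: eq_bigr => j _;
  case: ifP; rewrite ?mulr0// ?mulr1// mulrC.
Qed.

Let dual_feasibleP y :
  dual_feasible P y <-> lp_dual columns coef column_cost (dual_vector y).
Proof.
split.
  move=> [mu0 rc0] [p|d] /mem_columns.
    move=> Pp; rewrite (dotp_path y Pp) /=.
    by have := rc0 p Pp; rewrite /reduced_cost; lra.
  by move=> dd; rewrite dotp_surplus oppr_le0 mu0.
move=> dual; split.
  move=> j dj; have := dual (inr j) ((mem_columns (inr j)).2 dj).
  by rewrite dotp_surplus oppr_le0.
move=> p Pp; have := dual (inl p) ((mem_columns (inl p)).2 Pp).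
by rewrite (dotp_path y Pp) /= /reduced_cost; lra.
Qed.

Let sum_columns (w : column -> R) (f : column -> R) :
  \sum_(c <- columns) w c * f c =
  \sum_(p \in P) f (inl p) * w (inl p) + \sum_(d | is_depot d) w (inr d) * f (inr d).
Proof.
rewrite big_cat !big_map fsbig_finite//=; congr (_ + _).
  by apply: eq_bigr => p _; rewrite mulrC.
by rewrite big_enum.
Qed.

Let sum_surplus (w : column -> R) j :
  \sum_(d | is_depot d) w (inr d) * coef (inr d) (inl (inr j)) =
  if is_depot j then - w (inr j) else 0.
Proof.
case: ifP => dj.
  rewrite (bigD1 j)//= eqxx mulrN1 big1 ?addr0// => d /andP[_ /negbTE->].
  by rewrite oppr0 mulr0.
rewrite big1// => d dd; have [dE|] := eqVneq d j; first by rewrite -dE dd in dj.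
by move=> /= /negbTE->; rewrite oppr0 mulr0.
Qed.

Let primal_of z : master_feasible P z -> exists w,
  lp_primal columns coef rhs w /\
  \sum_(c <- columns) w c * column_cost c = master_value P z.
Proof.
move=> [[z0P z_ge0] zstart zend zvis].
pose w (c : column) := match c with
  | inl p => z p
  | inr d => if is_depot d then \sum_(p \in P) ends_at d p * z p - (vend d)%:R else 0
  end.
exists w; split; last first.
  by rewrite sum_columns [X in _ + X]big1 ?addr0// => d _; rewrite mulr0.
split.
  by move=> [p|d] /=; [exact: z_ge0|case: ifP => // dd; rewrite subr_ge0 zend].
move=> [[j|j]|i]; rewrite sum_columns /=.
- rewrite [X in _ + X]big1 ?addr0; last by move=> d _; rewrite mulr0.
  case: ifP => dj; first exact: zstart.
  by apply: fsbig1 => p _; rewrite mul0r.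
- rewrite (sum_surplus w j) /=; case: ifP => dj; first by rewrite dj opprB addrC subrK.
  by rewrite addr0; apply: fsbig1 => p _; rewrite mul0r.
- rewrite [X in _ + X]big1 ?addr0; last by move=> d _; rewrite mulr0.
  case: ifP => ci; first exact: zvis.
  by apply: fsbig1 => p _; rewrite mul0r.
Qed.

Let primal_to w : lp_primal columns coef rhs w -> exists z, master_feasible P z /\
  master_value P z = \sum_(c <- columns) w c * column_cost c.
Proof.
move=> [w_ge0 wE].
pose z p := if p \in P then w (inl p) else 0.
have zE (f : nodeseq I -> R) :
    \sum_(p \in P) f p * z p = \sum_(p \in P) f p * w (inl p).
  by apply: eq_fsbigr => p pP; rewrite /z pP.
exists z; split; last first.
  rewrite /master_value zE sum_columns [X in _ + X]big1 ?addr0// => d _.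
  by rewrite mulr0.
split.
- split=> p; rewrite /z; last by case: ifP => // _; exact: w_ge0.
  by move=> nPp; rewrite memNset.
- move=> j dj; have := wE (inl (inl j)); rewrite sum_columns /= dj.
  by rewrite [X in _ + X]big1 ?addr0 ?zE// => d _; rewrite mulr0.
- move=> j dj; have := wE (inl (inr j)); rewrite sum_columns (sum_surplus w j) /= dj zE.
  by move=> <-; rewrite gerBl w_ge0.
- move=> i ci; have := wE (inr i); rewrite sum_columns /= ci.
  by rewrite [X in _ + X]big1 ?addr0 ?zE// => d _; rewrite mulr0.
Qed.

Lemma master_weak_duality z y : master_feasible P z -> dual_feasible P y ->
  dual_value y <= master_value P z.
Proof.
move=> /primal_of[w [pw <-]] /dual_feasibleP dy; rewrite -dotp_rhs.
exact: (lp_weak_duality pw dy).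
Qed.

Lemma path_cost_ge0 p : P p -> 0 <= path_cost p.
Proof.
move=> /PF[[[arcs_p _ _] _] _]; case: p arcs_p => i q.
by apply: arc_sum_ge0; exact: cost_gt0.
Qed.

Lemma dual_feasible0 : dual_feasible P (Duals (fun=> 0) (fun=> 0) (fun=> 0)).
Proof.
split=> // p Pp; rewrite /reduced_cost /= !subr0 big1 ?subr0 ?path_cost_ge0//.
by move=> i _; rewrite mulr0.
Qed.

Lemma master_strong_duality z0 : master_feasible P z0 ->
  exists z y, [/\ master_feasible P z, dual_feasible P y &
                  master_value P z <= dual_value y].
Proof.
move=> /primal_of[w0 [pw0 _]].
have /dual_feasibleP dy0 := dual_feasible0.
have [w [u [pw du wu]]] := lp_strong_duality uniq_columns pw0 dy0.
have [z [fz zE]] := primal_to pw.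
pose y := Duals (fun j => u (inl (inl j))) (fun j => u (inl (inr j)))
  (fun i => u (inr i)).
have yE : dual_vector y = u by apply/funext => -[[j|j]|i].
exists z, y; split=> //; first by apply/dual_feasibleP; rewrite yE.
by rewrite zE -dotp_rhs yE.
Qed.

Lemma master_solvable z0 : master_feasible P z0 ->
  exists z y, master_optimal P z /\ dual_optimal P y.
Proof.
move=> /master_strong_duality[z [y [fz fy zy]]]; exists z, y; split; split=> //.
  by move=> z' fz'; apply: le_trans zy _; exact: master_weak_duality.
by move=> y' fy'; apply: le_trans zy; exact: master_weak_duality.
Qed.

Lemma optimal_values z y : master_optimal P z -> dual_optimal P y ->
  master_value P z <= dual_value y.
Proof.
move=> [fz optz] [fy opty]; have [z1 [y1 [fz1 fy1 zy1]]] := master_strong_duality fz.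
by apply: le_trans (optz _ fz1) _; apply: le_trans zy1 _; exact: opty.
Qed.

End FixedPaths.

(** An optimal solution for [P] remains optimal for any larger set of feasible paths
    for which the optimal dual solution is still feasible. *)
Lemma master_optimal_extend P P' z y : P `<=` P' -> P' `<=` @feasible_paths R I ->
  master_optimal P z -> dual_optimal P y -> dual_feasible P' y -> master_optimal P' z.
Proof.
move=> PP' P'F optz opty fy; have PF := subset_trans PP' P'F.
have [fz' vz'] := master_extend PP' optz.1; split=> // z' fz2.
rewrite vz'; apply: le_trans (optimal_values PF optz opty) _.
exact: master_weak_duality.
Qed.

End Master.

(** * Column generation *)

Section ColumnGeneration.
Variables (R : realType) (I : instance R).
Let F := @feasible_paths R I.

(** The invariant of column generation. *)
Definition cg_inv (s : cg_state I) : Prop :=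
  match s with
  | Master P => P `<=` F /\ exists z, master_feasible P z
  | Subpaths P z y st =>
      [/\ P `<=` F, master_optimal P z, dual_optimal P y & subpath_inv y st]
  | Paths P z y Sstar st =>
      [/\ P `<=` F, master_optimal P z, dual_optimal P y, covers_subpaths y Sstar &
          plabel_inv y Sstar st]
  | Returned z => master_optimal F z
  end.

(** Compared lexicographically: the number of missing feasible paths, the stage of
    the iteration, and the measure of the current label-setting loop. *)
Definition cg_measure (s : cg_state I) : (nat * nat) * (nat * nat) :=
  match s with
  | Master P => ((#|` fset_set (F `\` P)|, 3), (0, 0))
  | Subpaths P _ _ st =>
      ((#|` fset_set (F `\` P)|, 2), ls_measure (@subpath_labels R I) st)
  | Paths P _ _ _ st =>
      ((#|` fset_set (F `\` P)|, 1), ls_measure (@path_labels R I) st)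
  | Returned _ => ((0, 0), (0, 0))
  end%N.

Lemma cg_inv_step s s' : cg_inv s -> cg_step s s' ->
  cg_inv s' /\ lex4 (cg_measure s') (cg_measure s).
Proof.
move=> + ss'; case: ss' => {s s'}.
- move=> P z y optz opty [PF _]; split.
    by split=> //; exact: subpath_inv_init.
  by apply: left_slex; apply: right_slex; exact/ssrnat.ltP.
- move=> P z y st st' stst' [PF optz opty inv_st]; split.
    by split=> //; exact: subpath_inv_step stst'.
  by apply: right_slex; exact: subpath_measure_step stst'.
- move=> P z y st done_st [PF optz opty inv_st]; split.
    by split=> //; [exact: first_phase_covers|exact: plabel_inv_init].
  by apply: left_slex; apply: right_slex; exact/ssrnat.ltP.
- move=> P z y Sstar st st' stst' [PF optz opty covS inv_st]; split.
    by split=> //; exact: plabel_inv_step stst'.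
  by apply: right_slex; exact: plabel_measure_step stst'.
- move=> P z y Sstar st done_st new0 [PF optz opty covS inv_st]; split.
    apply: (master_optimal_extend PF _ optz opty) => //; split.
      by case: opty => -[].
    move=> p Fp; rewrite leNgt; apply/negP => rc.
    by have [p'] := pricing_exact covS inv_st done_st Fp rc; rewrite new0.
  apply: left_slex => /=; case: (#|` _|) => [|n].
    by apply: right_slex; exact/ssrnat.ltP.
  by apply: left_slex; exact/ssrnat.ltP.
- move=> P z y Sstar st done_st /eqP/set0P[p newp] [PF optz opty covS inv_st].
  have newF : P `|` new_paths y st `<=` F.
    by move=> p' [/PF//|/(new_paths_feasible inv_st)[]].
  have [Fp rc] := new_paths_feasible inv_st newp; split.
    split=> //; exists z.
    by have [] := master_extend (@subsetUl _ P (new_paths y st)) optz.1.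
  apply: left_slex; apply: left_slex; apply/ssrnat.ltP.
  apply: (@card_setD_proper _ _ _ _ p) => //; [exact: finite_feasible_paths| |by right].
  by case: opty => -[_ rc_ge0] _ Pp; have := rc_ge0 p Pp; rewrite leNgt rc.
Qed.

Lemma cg_progress s : cg_inv s -> (forall s', ~ cg_step s s') ->
  exists2 z, s = Returned z & master_optimal F z.
Proof.
case: s => [P|P z y st|P z y Sstar st|z] /=; last by move=> optz _; exists z.
- move=> [PF [z0 fz0]] stuck; exfalso.
  have [z [y [optz opty]]] := master_solvable PF fz0.
  exact: stuck (CGSolve optz opty).
- move=> [PF optz opty inv_st] stuck; exfalso.
  have [done_st|[st' stst']] := subpath_progress inv_st.
    exact: stuck (CGSubpathsDone P z y done_st).
  exact: stuck (CGSubpath P z stst').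
- move=> [PF optz opty covS inv_st] stuck; exfalso.
  have [done_st|[st' stst']] := plabel_progress inv_st.
    have [new0|newN0] := pselect (new_paths y st = set0).
      exact: stuck (CGStop P z Sstar done_st new0).
    exact: stuck (CGContinue P z Sstar done_st newN0).
  exact: stuck (CGPath P z stst').
Qed.

End ColumnGeneration.

Theorem corollary1 (R : realType) (I : instance R) (P0 : set (nodeseq I))
    (P0_sub : P0 `<=` feasible_paths (I:=I))
    (P0_feasible : exists z : nodeseq I -> R, master_feasible P0 z) :
  always_ends_in (cg_step (I:=I)) (Master P0)
    (fun s => exists2 z : nodeseq I -> R,
       s = Returned z & master_optimal (feasible_paths (I:=I)) z).
Proof.
have inv0 : cg_inv (Master P0) by [].
split.
  by apply: (no_infinite_descent wf_lex4 inv0) => s s'; exact: cg_inv_step.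
move=> s reach stuck; apply: cg_progress stuck.
elim: reach inv0 => [s1 s2 s12|//|s1 s2 s3 _ IH12 _ IH23] inv1.
  by have [] := cg_inv_step inv1 s12.
exact/IH23/IH12.
Qed.
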